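(* Let $F=F(N,\mathcal D)$ be a non-fragile connected GSC. Then $F$ has a cut point if and only if $\chi(\Gamma_k)\ge|\mathcal D|^{k-1}$ for all $k\ge2$. Moreover, if there exists $k_0\ge2$ such that $\chi(\Gamma_k)\ge|\mathcal D|^{k-1}$ for all $k\ge k_0$, then $F$ has a cut point.
   Context: GSC: $N\ge2$, $\mathcal D\subset\{0,\dots,N-1\}^2$ with $1<|\mathcal D|<N^2$, $\varphi_i(x)=\frac1N(x+i)$, $F$ the attractor $F=\bigcup_{i\in\mathcal D}\varphi_i(F)$; $\varphi_{i_1\cdots i_k}=\varphi_{i_1}\circ\cdots\circ\varphi_{i_k}$. $\Gamma_k$: vertex set $\mathcal D^k$, edge between distinct $\mathbf i,\mathbf j$ iff $\varphi_{\mathbf i}(F)\cap\varphi_{\mathbf j}(F)\ne\varnothing$. $\chi(G)$ for a connected graph $G$: max over cut vertices $v$ of the number of vertices of the second largest component of $G-\{v\}$ (0 if no cut vertex). A connected GSC $F$ is fragile if there is a partition $\mathcal D=\mathcal D_1\cup\mathcal D_2$ into disjoint nonempty sets such that $\big(\bigcup_{i\in\mathcal D_1}\varphi_i(F)\big)\cap\big(\bigcup_{i\in\mathcal D_2}\varphi_i(F)\big)$ is a singleton; non-fragile otherwise. *)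

(* Defs.v *)
From HB Require Import structures.
From mathcomp Require Import all_boot all_order all_algebra.
From mathcomp Require Import all_classical all_reals all_analysis.

Set Implicit Arguments.
Unset Strict Implicit.
Unset Printing Implicit Defensive.

Import Order.TTheory GRing.Theory Num.Theory.
Import numFieldNormedType.Exports.
Local Open Scope classical_set_scope.
Local Open Scope ring_scope.

Section GSC.
Variables (R : realType) (N : nat).

Definition digit := ('I_N * 'I_N)%type.

Definition phi (i : digit) (x : R * R) : R * R :=
  ((x.1 + (i.1 : nat)%:R) / N%:R, (x.2 + (i.2 : nat)%:R) / N%:R).

Definition phiw (w : seq digit) : R * R -> R * R :=
  foldr (fun i f => phi i \o f) id w.

Definition Uimg (A : {set digit}) (F : set (R * R)) : set (R * R) :=
  \bigcup_(i in [set i | i \in A]) (phi i @` F).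

(* F is the attractor of the GSC with digit set D: the (unique, by Hutchinson)
   nonempty compact set with F = U_{i in D} phi_i(F). *)
Definition is_attractor (D : {set digit}) (F : set (R * R)) : Prop :=
  [/\ F !=set0, compact F & F = Uimg D F].

Definition fragile (D : {set digit}) (F : set (R * R)) : Prop :=
  exists D1 : {set digit},
    [/\ D1 \subset D, D1 != finset.set0, (D :\: D1) != finset.set0 &
        exists x : R * R, Uimg D1 F `&` Uimg (D :\: D1) F = [set x]].

Definition has_cut_point (F : set (R * R)) : Prop :=
  exists x, F x /\ ~ connected (F `\` [set x]).

Definition verts (D : {set digit}) (k : nat) : {set k.-tuple digit} :=
  [set t : k.-tuple digit | all (fun i => i \in D) t].

Definition gedge (F : set (R * R)) (k : nat) : rel (k.-tuple digit) :=
  fun s t => (s != t) && `[< (phiw s @` F) `&` (phiw t @` F) !=set0 >].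

End GSC.

Arguments gedge {R N} F k.
Arguments verts {N} D k.

Section Graph.
Variables (T : finType) (V : {set T}) (e : rel T).

Definition restr (W : {set T}) : rel T := fun x y => [&& x \in W, y \in W & e x y].

Definition components (W : {set T}) : {set {set T}} :=
  [set [set y in W | connect (restr W) x y] | x in W].

Definition cut_vertex (v : T) : bool :=
  (v \in V) && (1 < #|components (V :\ v)|)%N.

Definition second_largest (v : T) : nat :=
  nth 0%N (sort geq (map (fun C : {set T} => #|C|) (fintype.enum (components (V :\ v))))) 1.

Definition chi : nat := \max_(v in V | cut_vertex v) second_largest v.

End Graph.

Definition chiGamma (R : realType) (N : nat) (D : {set digit N})
  (F : set (R * R)) (k : nat) : nat :=
  chi (verts D k) (gedge F k).

(* Main.v *)
Require Import Defs.
From HB Require Import structures.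
From mathcomp Require Import all_boot all_order all_algebra.
From mathcomp Require Import all_classical all_reals all_analysis.
From mathcomp Require Import zify ring lra.
Import numFieldNormedType.Exports.

(** Large components of Gamma_k minus a vertex v_k give a cut point: the cells
    of the v_k accumulate at a point x, and since F is locally connected (the
    cells of level m around a point form a connected neighbourhood) the two
    sides pass to the limit as relatively open parts of F minus x.  Both parts
    are nonempty, because at most 16 cells of level 6 are near x, and they
    contain fewer than |D|^(k-1) cells of level k.

    Conversely, let x be a cut point with sides U and V.  Non-fragility yields
    a piece phi_a(F) containing x and meeting both sides, so cut points can be
    zoomed into; each zoom into one of several cells containing x lowers the
    number of cells around it, hence we may assume that x has a unique address
    a b c ...  If two pieces lie on different sides of x, the cell of level k
    containing x is the required cut vertex.  Otherwise all pieces other than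
    that of a lie on one side, and the same holds after each zoom.  If this
    side never changes, the other side shrinks to x.  If it changes at the
    first zoom, the set T(a) of points of F that phi_a sends to another piece
    lies in phi_b(F).  Non-fragility gives T(a) two points, and then a study of
    the sides of the square shows that T(a) is not contained in a cell of level
    two, while T(b) is not contained in a piece; one of these inclusions holds
    after the second zoom. *)

Set Implicit Arguments.
Unset Strict Implicit.
Unset Printing Implicit Defensive.

Import Order.TTheory GRing.Theory Num.Theory.
Local Open Scope classical_set_scope.
Local Open Scope ring_scope.

(** * Digit systems on the interval *)

(** The integer [b - c] equals [z - y], hence is -1, 0 or 1, and the extreme values push [y] and [z]
    to opposite ends. This governs how a point can lie in two pieces. *)
Lemma carry (R : realType) (y z : R) (b c : nat) : 0 <= y <= 1 -> 0 <= z <= 1 ->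
  y + b%:R = z + c%:R ->
  [\/ b = c /\ y = z, [/\ c = b.+1, y = 1 & z = 0] |
      [/\ b = c.+1, y = 0 & z = 1]].
Proof.
move=> /andP[y0 y1] /andP[z0 z1] e.
have h1 : (b <= c.+1)%N by rewrite -(ler_nat R) -natr1; lra.
have h2 : (c <= b.+1)%N by rewrite -(ler_nat R) -natr1; lra.
have [bc|cb|bc] := ltngtP b c.
- apply: Or32; have ec : c = b.+1 by lia.
  by move: e; rewrite ec -natr1 => e; split=> //; lra.
- apply: Or33; have ec : b = c.+1 by lia.
  by move: e; rewrite ec -natr1 => e; split=> //; lra.
- by apply: Or31; split=> //; move: e; rewrite bc => e; lra.
Qed.

Section DigitSystems.
Variables (R : realType) (N : nat).
Hypothesis N_gt1 : (1 < N)%N.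

Lemma natr_ge2 : 2 <= N%:R :> R.
Proof. by rewrite (ler_nat R 2). Qed.

Lemma natr_neq0 : N%:R != 0 :> R.
Proof. by have := natr_ge2; lra. Qed.

(** Replaces passages to the limit: a quantity that stays bounded under repeated expansion by [N]
    cannot be positive. *)
Lemma geometric_le0 (C d : R) : (forall k, d * N%:R ^+ k <= C) -> d <= 0.
Proof.
move=> hd; rewrite leNgt; apply/negP => d0.
pose k := Num.bound (`|C| / d).
have hk : `|C| / d < k%:R by apply: archi_boundP; rewrite divr_ge0 // ltW.
have hN : k%:R <= N%:R ^+ k :> R.
  by rewrite -natrX ler_nat; apply/ltnW/ltn_expl.
have := hd k; apply/negP; rewrite -ltNge.
apply: (le_lt_trans (ler_norm C)); rewrite mulrC -ltr_pdivrMr //.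
exact: lt_le_trans hN.
Qed.

(* [S] is the attractor, in [0, 1], of the maps t |-> (t + r) / N, r in [D];
   the denominator is cleared. *)
Definition digit_system (S : R -> Prop) (D : nat -> Prop) :=
  [/\ forall t, S t -> 0 <= t <= 1, forall r, D r -> (r < N)%N &
      forall t, S t <-> exists r u, [/\ D r, S u & t * N%:R = u + r%:R]].

(** Reflection exchanges upward and downward carries, so that only one direction has to be
    studied. *)
Definition flip (S : R -> Prop) (t : R) := S (1 - t).
Definition flip_digit (D : nat -> Prop) (r : nat) := (r < N)%N /\ D (N.-1 - r)%N.

Lemma digit_system_flip S D :
  digit_system S D -> digit_system (flip S) (flip_digit D).
Proof.
move=> [S01 DN SE]; split.
- by move=> t /S01 /andP[h1 h2]; apply/andP; split; lra.
- by move=> r [].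
- have natE r : (r < N)%N -> (N.-1 - r)%:R = N%:R - 1 - r%:R :> R.
    move=> rN; rewrite natrB; last by lia.
    by rewrite -subn1 natrB //; lia.
  move=> t; rewrite /flip SE; split.
  + move=> [r [u [Dr Su e]]]; exists (N.-1 - r)%N, (1 - u).
    have rN := DN _ Dr; split.
    * split; first by lia.
      by have -> : (N.-1 - (N.-1 - r) = r)%N by lia.
    * by rewrite opprB addrCA subrr addr0.
    * by rewrite natE //; lra.
  + move=> [r [u [[rN Dr] Su e]]]; exists (N.-1 - r)%N, (1 - u).
    by split=> //; rewrite natE //; lra.
Qed.

(** * Intersections of two digit systems confined to one piece *)

Section OnePair.
Variables (A B : R -> Prop) (DA DB : nat -> Prop) (b : nat).
Hypotheses (hA : digit_system A DA) (hB : digit_system B DB).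
Hypothesis DAb : DA b.

(** [A] and [B] will be opposite sides of [F] laid on each other, as happens where two adjacent
    pieces touch. *)
Definition pinched :=
  forall y, A y -> B y -> exists2 u, A u & y * N%:R = u + b%:R.

Hypothesis hE : pinched.

(** Piece [b] has length at most 1/2 and cannot contain both ends. *)
Lemma pinched_ends : ~ ((A 0 /\ B 0) /\ (A 1 /\ B 1)).
Proof.
have [A01 _ _] := hA.
move=> [[A0 B0] [A1 B1]]; have N2 := natr_ge2.
have [u Au e0] := hE A0 B0; have [v Av e1] := hE A1 B1.
have := A01 _ Au => /andP[]; have := A01 _ Av => /andP[].
have : 0 <= b%:R :> R by [].
lra.
Qed.

(** Compare the expansion of [y] in [A], with digit [b], to one in [B]: the preimage [u] is again a
    common point unless a carry puts it at an end. *)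
Lemma pinched_preimage y : A y -> B y ->
  exists u, [/\ A u, y * N%:R = u + b%:R &
   [\/ B u /\ DB b, [/\ u = 1, B 0 & DB b.+1] |
      exists c, [/\ b = c.+1, u = 0, B 1 & DB c]]].
Proof.
have [A01 _ _] := hA; have [B01 _ BE] := hB.
move=> Ay By; have [u Au eu] := hE Ay By.
have /BE [c [v [Dc Bv ev]]] := By.
exists u; split=> //.
have e : u + b%:R = v + c%:R by rewrite -eu.
have [[ec euv]|[ec eu1 ev0]|[ec eu0 ev1]] := carry (A01 _ Au) (B01 _ Bv) e.
- by apply: Or31; rewrite euv ec.
- by apply: Or32; rewrite -ec; split=> //; rewrite -ev0.
- by apply: Or33; exists c; split=> //; rewrite -ev1.
Qed.

(** The map y |-> N y - b preserves the common points and multiplies their differences by [N], while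
    these stay at most 1. *)
Lemma pinched_invariant_eq y z : A y -> B y -> A z -> B z ->
  (forall u, A u -> B u -> exists v, [/\ A v, B v & u * N%:R = v + b%:R]) ->
  y = z.
Proof.
move=> Ay By Az Bz inv; have [A01 _ _] := hA.
suff H : forall y z, A y -> B y -> A z -> B z -> y - z <= 0.
  by have h1 := H _ _ Ay By Az Bz; have h2 := H _ _ Az Bz Ay By; lra.
move=> {Ay By Az Bz} {}y {}z Ay By Az Bz.
apply: (geometric_le0 (C := 1)) => k.
elim: k y z Ay By Az Bz => [|k IH] y z Ay By Az Bz.
  by have := A01 _ Ay => /andP[? ?]; have := A01 _ Az => /andP[? ?]; lra.
have [y' [Ay' By' ey]] := inv _ Ay By.
have [z' [Az' Bz' ez]] := inv _ Az Bz.
rewrite exprS mulrA mulrBl ey ez.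
by have := IH _ _ Ay' By' Az' Bz'; congr (_ <= _); congr (_ * _); lra.
Qed.

(* An intersection A /\ B with two points that lies in one piece of A is not
   invariant under that piece, so that it contains the image of a common
   corner of A and of the neighbouring piece of B. *)
Definition rises := [/\ A 1, B 0, DB b.+1 & DB b].

Lemma rises_not1 : rises -> ~ B 1.
Proof.
move=> [A1 B0 Db1 _] B1; have N2 := natr_ge2.
have [A01 DN _] := hA; have [_ DBN _] := hB.
have [u Au eu] := hE A1 B1.
have /andP[_ u1] := A01 _ Au.
have := DBN _ Db1; rewrite -(ler_nat R) -!natr1; lra.
Qed.

Lemma rises_mem : rises -> exists y, [/\ A y, B y & y * N%:R = b.+1%:R].
Proof.
move=> [A1 B0 Db1 _]; have [_ _ AE] := hA; have [_ _ BE] := hB.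
have N0 := natr_neq0.
exists (b.+1%:R / N%:R); rewrite divfK //; split=> //.
- by apply/AE; exists b, 1; rewrite divfK // -natr1 addrC.
- by apply/BE; exists b.+1, 0; rewrite divfK // add0r.
Qed.

Hypothesis rise : rises.
Variables p q : R.
Hypotheses (Ap : A p) (Bp : B p) (Aq : A q) (Bq : B q) (pq : p <> q).

Lemma mem_piece y c : A y -> B y -> y * N%:R - c%:R <= 1 -> 0 <= y * N%:R - c%:R ->
  c = b \/ y * N%:R = b%:R \/ y * N%:R = b.+1%:R.
Proof.
move=> Ay By h1 h0; have [A01 _ _] := hA.
have [u Au eu] := hE Ay By.
have e : u + b%:R = (y * N%:R - c%:R) + c%:R by rewrite subrK eu.
have h01 : 0 <= y * N%:R - c%:R <= 1 by rewrite h0 h1.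
have [[ec _]|[_ u1 _]|[_ u0 _]] := carry (A01 _ Au) h01 e.
- by left.
- by right; right; rewrite eu u1 -natr1 addrC.
- by right; left; rewrite eu u0 add0r.
Qed.

(** If [c] = [b], the point (b + 1)/N would put 1 into [B]. Otherwise every common point is an end
    of piece [b], so [p] and [q] are its two ends, and a different piece cannot contain both. *)
Lemma rises_B_piece c : DB c ->
  ~ (forall y, A y -> B y -> exists2 v, B v & y * N%:R = v + c%:R).
Proof.
move=> Dc H; have N2 := natr_ge2; have [A01 _ _] := hA; have [B01 _ _] := hB.
have bc y : A y -> B y -> c = b \/ y * N%:R = b%:R \/ y * N%:R = b.+1%:R.
  move=> Ay By; have [v Bv ev] := H _ Ay By; have /andP[v0 v1] := B01 _ Bv.
  by apply: mem_piece; rewrite ?ev ?addrK.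
have [y [Ay By ey]] := rises_mem rise.
have [v Bv ev] := H _ Ay By.
case: (eqVneq c b) => [ecb|ncb].
  apply: (rises_not1 rise); have -> : 1 = v; last by [].
  by move: ev; rewrite ey ecb -natr1; lra.
have NN := natr_neq0.
have key x x' : A x -> B x -> A x' -> B x' -> x * N%:R = b%:R -> x' * N%:R = b.+1%:R -> False.
  move=> Ax Bx Ax' Bx' ex ex'.
  have [v' /B01/andP[? ?] ev'] := H _ Ax Bx.
  have [v'' /B01/andP[? ?] ev''] := H _ Ax' Bx'.
  case: (ltngtP c b) ncb => // cb _.
    by move: cb; rewrite -(ler_nat R) -natr1; rewrite -natr1 in ex'; lra.
  by move: cb; rewrite -(ler_nat R) -natr1; rewrite -natr1 in ex'; lra.
have inj (x x' : R) : x * N%:R = x' * N%:R -> x = x' by exact: mulIf.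
case: (bc _ Ap Bp) => [e|[ep|ep]]; first by rewrite e eqxx in ncb.
all: case: (bc _ Aq Bq) => [e|[eq|eq]]; first by rewrite e eqxx in ncb.
- by apply: pq; apply: inj; rewrite ep.
- exact: (key p q).
- exact: (key q p).
- by apply: pq; apply: inj; rewrite ep.
Qed.

(** Otherwise digit b + 1 sends common points to common points; these must lie in piece [b], which
    leaves 0 as the only common point. *)
Lemma rises_A_next : ~ DA b.+1.
Proof.
move=> Db; have N2 := natr_ge2; have [A01 _ AE] := hA; have [B01 _ BE] := hB.
have [_ _ Db1 _] := rise.
have NN := natr_neq0.
have H y : A y -> B y -> y = 0.
  move=> Ay By.
  have /AE Az : exists r u, [/\ DA r, A u & (y + b.+1%:R) / N%:R * N%:R = u + r%:R].
    by exists b.+1, y; rewrite divfK.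
  have /BE Bz : exists r u, [/\ DB r, B u & (y + b.+1%:R) / N%:R * N%:R = u + r%:R].
    by exists b.+1, y; rewrite divfK.
  have [u /A01/andP[? ?]] := hE Az Bz; rewrite divfK // -natr1 => e.
  by have /andP[? ?] := A01 _ Ay; lra.
by apply: pq; rewrite (H _ Ap Bp) (H _ Aq Bq).
Qed.

(** Otherwise b/N is a common point. Being in piece [b], it forces 0 into [A]; then 0 is a common
    point outside piece [b]. *)
Lemma rises_A_prev c : b = c.+1 -> ~ DA c.
Proof.
have N2 := natr_ge2; have [A01 _ AE] := hA; have [B01 _ BE] := hB.
have [A1 B0 Db1 Db] := rise.
have NN := natr_neq0.
move=> ebc Dc.
have /AE Az : exists r u, [/\ DA r, A u & b%:R / N%:R * N%:R = u + r%:R].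
  by exists c, 1; rewrite divfK // ebc -natr1 addrC.
have /BE Bz : exists r u, [/\ DB r, B u & b%:R / N%:R * N%:R = u + r%:R].
  by exists b, 0; rewrite divfK // add0r.
have [u Au] := hE Az Bz; rewrite divfK // => e.
have A0 : A 0 by have -> : 0 = u by lra.
have [v /A01/andP[? ?]] := hE A0 B0.
rewrite mul0r ebc -natr1 => e'.
have : 0 <= c%:R :> R by [].
lra.
Qed.

(** Let y = (b + 1)/N. Any common point other than [y] turns out to be the image of [y] under digit
    [b]. The image of such a point [z] under [b] is common too and differs from [y] since 1 is not
    in [B]; comparing both, z = y. *)
Lemma rises_subpiece c :
  ~ (forall y, A y -> B y -> exists u v, [/\ A u, A v, y * N%:R = u + b%:R & u * N%:R = v + c%:R]).
Proof.
move=> H; have N2 := natr_ge2; have [A01 _ AE] := hA; have [B01 DBN BE] := hB.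
have [A1 B0 Db1 Db] := rise.
have NN := natr_neq0.
have nB1 := rises_not1 rise.
have [y [Ay By ey]] := rises_mem rise.
have ec : c%:R = N%:R - 1 :> R.
  have [u [v [Au Av eu ev]]] := H _ Ay By.
  have u1 : u = 1 by move: eu; rewrite ey -natr1; lra.
  have eN : N = N.-1.+1 by lia.
  have := ev; rewrite u1 mul1r -[LHS]add0r {1}eN => e.
  have h01 : 0 <= v <= 1 := A01 _ Av.
  have : 1 + N.-1%:R = v + c%:R by rewrite addrC natr1; lra.
  move=> /(carry _ h01) -[|[<- _]|[cN _ v0]|[_ /eqP]].
  - by apply/andP.
  - by rewrite eN -natr1 /=; lra.
  (* If [c] were N, every common point would have preimage 1 and hence equal [y]. *)
  - have := H _ Ay By.
    have [z [Az Bz zy]] : exists z, [/\ A z, B z & z <> y].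
      have [e1|n1] := eqVneq p y; last by exists p; split=> //; apply/eqP.
      by exists q; split=> // e2; apply: pq; rewrite e1.
    have [w [x [Aw Ax ew ex]]] := H _ Az Bz.
    have /andP[? ?] := A01 _ Aw; have /andP[? ?] := A01 _ Ax.
    exfalso; apply: zy; apply: (mulIf NN); rewrite ey ew.
    have -> : w = 1; last by rewrite addrC natr1.
    apply: (mulIf NN); move: ex; rewrite cN -eN; nra.
  - by rewrite oner_eq0.
have {}H z : A z -> B z -> z <> y -> z * N%:R = y + b%:R.
  move=> Az Bz zy; have [u [v [Au Av eu ev]]] := H _ Az Bz.
  have [w [Aw ew [[Bw _]|[w1 _ _]|[d [_ w0 B1 _]]]]] := pinched_preimage Az Bz.
  (* Piece [b] gives N w <= b + 1 <= N - 1 and piece [c] gives N w >= N - 1, so that w = (b + 1)/N =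
     y. *)
  - have euw : u = w by lra.
    have [t At et] := hE Aw Bw.
    have /andP[? ?] := A01 _ At; have /andP[? ?] := A01 _ Av.
    have bN : b.+1%:R <= N%:R - 1 :> R.
      by have := DBN _ Db1; rewrite -(ler_nat R) -natr1; lra.
    have -> : y = w; last by lra.
    apply: (mulIf NN); rewrite ey et; move: bN; rewrite -natr1; nra.
  - by exfalso; apply: zy; apply: (mulIf NN); rewrite ey ew w1 addrC natr1.
  - by case: nB1.
have bad z : A z -> B z -> z <> y -> False.
  move=> Az Bz zy.
  have ez := H _ Az Bz zy.
  have /AE Ax : exists r u, [/\ DA r, A u & (z + b%:R) / N%:R * N%:R = u + r%:R].
    by exists b, z; rewrite divfK.
  have /BE Bx : exists r u, [/\ DB r, B u & (z + b%:R) / N%:R * N%:R = u + r%:R].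
    by exists b, z; rewrite divfK.
  have xy : (z + b%:R) / N%:R <> y.
    move=> e; apply: nB1; have -> : 1 = z; last by [].
    by move: ey; rewrite -e divfK // -natr1; lra.
  have := H _ Ax Bx xy; rewrite divfK // => e.
  by apply: zy; lra.
case: (eqVneq p y) => [e|/eqP n]; last exact: (bad p).
by apply: (bad q) => // e'; apply: pq; rewrite e.
Qed.

End OnePair.

Lemma flip_digitE (b : nat) : (b < N)%N ->
  (N.-1 - b < N)%N /\ (N.-1 - (N.-1 - b))%N = b.
Proof. by move=> ?; lia. Qed.

Lemma natr_flip (b : nat) : (b < N)%N ->
  (N.-1 - b)%:R = N%:R - 1 - b%:R :> R.
Proof. by move=> bN; rewrite natrB -?subn1 ?natrB //; lia. Qed.

Lemma pinched_flip (A B : R -> Prop) (b : nat) : (b < N)%N ->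
  pinched A B b -> pinched (flip A) (flip B) (N.-1 - b).
Proof.
move=> bN hE y Ay By; have [u Au eu] := hE _ Ay By.
exists (1 - u); first by rewrite /flip opprB addrCA subrr addr0.
by rewrite natr_flip //; lra.
Qed.

Lemma flipK (A : R -> Prop) t : A t -> flip A (1 - t).
Proof. by rewrite /flip opprB addrCA subrr addr0. Qed.

Section Pinched.
Variables (A B : R -> Prop) (DA DB : nat -> Prop) (b : nat).
Hypotheses (hA : digit_system A DA) (hB : digit_system B DB).
Hypotheses (DAb : DA b) (hE : pinched A B b).

Let bN : (b < N)%N. Proof. by have [_ DN _] := hA; apply: DN. Qed.
Let hA' := digit_system_flip hA.
Let hB' := digit_system_flip hB.
Let hE' := pinched_flip bN hE.

Section TwoPoints.
Variables p q : R.
Hypotheses (Ap : A p) (Bp : B p) (Aq : A q) (Bq : B q) (pq : p <> q).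

Let pq' : 1 - p <> 1 - q. Proof. by move=> e; apply: pq; lra. Qed.

(** If [b] is not a digit of [B], every common point comes from a carry; carries in both directions
    would make both ends common, and one direction yields a single point. If [b] is a digit of [B]
    and no carry occurs, the intersection is invariant, hence again a single point. *)
Lemma pinched_rises : rises A B DB b \/
  rises (flip A) (flip B) (flip_digit DB) (N.-1 - b).
Proof.
have [//|nup] := pselect (rises A B DB b); first by left.
right; apply: contrapT => ndown.
have B01 : ~ (B 0 /\ B 1 /\ A 0 /\ A 1).
  by move=> [? [? [? ?]]]; apply: (pinched_ends hA hE).
have [_ DBN _] := hB.
have flip0 S : flip S 0 <-> S 1 by rewrite /flip subr0.
have flip1 S : flip S 1 <-> S 0 by rewrite /flip subrr.
have DBb : DB b.
  apply: contrapT => nDb.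
  have [|] := pselect (A 1 /\ B 0 /\ DB b.+1) => up.
  - have H y : A y -> B y -> y * N%:R = b.+1%:R.
      move=> Ay By; have [u [Au eu]] := pinched_preimage hA hB hE Ay By.
      move=> [[_ //]|[u1 _ _]|[c [_ u0 B1 _]]].
      - by rewrite eu u1 -natr1 addrC.
      - by case: B01; do !split=> //; rewrite ?u0 in Au; tauto.
    have NN := natr_neq0.
    by apply: pq; apply: (mulIf NN); rewrite H // H.
  - have H y : A y -> B y -> y * N%:R = b%:R.
      move=> Ay By; have [u [Au eu]] := pinched_preimage hA hB hE Ay By.
      move=> [[_ //]|[u1 B0 Db]|[c [_ u0 _ _]]].
      - by case: up; rewrite -u1.
      - by rewrite eu u0 add0r.
    have NN := natr_neq0.
    by apply: pq; apply: (mulIf NN); rewrite H // H.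
apply: pq; apply: (pinched_invariant_eq (b := b) hA Ap Bp Aq Bq) => u Au Bu.
have [v [Av ev]] := pinched_preimage hA hB hE Au Bu.
move=> [[Bv _]|[v1 B0 Db]|[c [ebc v0 B1 Dc]]]; first by exists v.
- by case: nup; split=> //; rewrite -v1.
- case: ndown; split.
  + by apply/flip1; rewrite -v0.
  + exact/flip0.
  + split; first by lia.
    by have -> : (N.-1 - (N.-1 - b).+1)%N = c by lia.
  + by split; [lia|rewrite (flip_digitE bN).2].
Qed.

Lemma pinched_B_piece c : DB c ->
  ~ (forall y, A y -> B y -> exists2 v, B v & y * N%:R = v + c%:R).
Proof.
move=> Dc H; have [_ DBN _] := hB; have cN := DBN _ Dc.
have [rise|rise] := pinched_rises.
  exact: (rises_B_piece hA hB DAb hE rise Ap Bp Aq Bq pq Dc H).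
have Dc' : flip_digit DB (N.-1 - c) by split; [lia|rewrite (flip_digitE cN).2].
have Db' : flip_digit DA (N.-1 - b) by split; [lia|rewrite (flip_digitE bN).2].
apply: (rises_B_piece hA' hB' Db' hE' rise (flipK Ap) (flipK Bp) (flipK Aq)
  (flipK Bq) pq' Dc').
move=> y Ay By; have [v Bv ev] := H _ Ay By.
by exists (1 - v); [exact: flipK|rewrite natr_flip //; lra].
Qed.

Lemma pinched_A_adjacent c : b = c.+1 \/ c = b.+1 -> ~ DA c.
Proof.
move=> bc Dc; have [_ DAN _] := hA; have cN := DAN _ Dc.
have Dc' : flip_digit DA (N.-1 - c) by split; [lia|rewrite (flip_digitE cN).2].
have Db' : flip_digit DA (N.-1 - b) by split; [lia|rewrite (flip_digitE bN).2].
have [rise|rise] := pinched_rises.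
  case: bc => e.
    exact: (rises_A_prev hA hB hE rise e Dc).
  rewrite e in Dc.
  exact: (rises_A_next hA hB hE rise Ap Bp Aq Bq pq Dc).
case: bc => e.
  have ec : (N.-1 - c = (N.-1 - b).+1)%N by lia.
  rewrite ec in Dc'.
  exact: (rises_A_next hA' hB' hE' rise (flipK Ap) (flipK Bp) (flipK Aq)
    (flipK Bq) pq' Dc').
have ec : (N.-1 - b = (N.-1 - c).+1)%N by lia.
exact: (rises_A_prev hA' hB' hE' rise ec Dc').
Qed.

Lemma pinched_subpiece c : (c < N)%N ->
  ~ (forall y, A y -> B y -> exists u v, [/\ A u, A v, y * N%:R = u + b%:R & u * N%:R = v + c%:R]).
Proof.
move=> cN H; have [rise|rise] := pinched_rises.
  exact: (rises_subpiece hA hB DAb hE rise Ap Bp Aq Bq pq H).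
have Db' : flip_digit DA (N.-1 - b) by split; [lia|rewrite (flip_digitE bN).2].
apply: (rises_subpiece hA' hB' Db' hE' rise (flipK Ap) (flipK Bp) (flipK Aq)
  (flipK Bq) pq' (c := N.-1 - c)).
move=> y Ay By; have [u [v [Au Av eu ev]]] := H _ Ay By.
exists (1 - u), (1 - v); split; try exact: flipK.
  by rewrite natr_flip //; lra.
by rewrite natr_flip //; lra.
Qed.

End TwoPoints.

(** Either the preimage or the image of [y] under the last digit is again common, so uniqueness
    makes [y] the fixed point of that map. An upward carry is impossible as b + 1 = N. *)
Lemma pinched_last_unique y : b = N.-1 -> A y -> B y ->
  (forall z, A z -> B z -> z = y) -> y = 1.
Proof.
move=> eb Ay By uniqE; have N2 := natr_ge2.
have [A01 _ AE] := hA; have [B01 DBN BE] := hB.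
have NN := natr_neq0.
have ebR : b%:R = N%:R - 1 :> R by rewrite eb -subn1 natrB //; lia.
have fix1 (z : R) : z * N%:R = z + b%:R -> z = 1.
  rewrite ebR => e; have /eqP : (z - 1) * (N%:R - 1) = 0 by lra.
  by rewrite mulf_eq0 => /orP[/eqP|/eqP]; lra.
have [u [Au eu]] := pinched_preimage hA hB hE Ay By.
move=> [[Bu _]|[_ _ /DBN]|[c [ebc u0 B1 Dc]]]; last 2 first.
- by lia.
- have /BE [c' [v [Dc' Bv ev]]] := B1.
  have /andP[v0 v1] := B01 _ Bv.
  have c'N := DBN _ Dc'.
  have ec' : c' = b.
    have : (N <= c'.+1)%N by rewrite -(ler_nat R) -natr1; lra.
    by lia.
  rewrite ec' in Dc'.
  have /AE Az : exists r u, [/\ DA r, A u & (y + b%:R) / N%:R * N%:R = u + r%:R].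
    by exists b, y; rewrite divfK.
  have /BE Bz : exists r u, [/\ DB r, B u & (y + b%:R) / N%:R * N%:R = u + r%:R].
    by exists b, y; rewrite divfK.
  by apply: fix1; rewrite -{1}(uniqE _ Az Bz) divfK.
- by apply: fix1; rewrite -{2}(uniqE _ Au Bu).
Qed.

End Pinched.

Lemma pinched_first_unique (A B : R -> Prop) (DA DB : nat -> Prop) y :
  digit_system A DA -> digit_system B DB -> DA 0%N -> pinched A B 0 ->
  A y -> B y -> (forall z, A z -> B z -> z = y) -> y = 0.
Proof.
move=> hA hB DA0 hE Ay By uniqE.
have N0 : (0 < N)%N by lia.
suff : 1 - y = 1 by lra.
have DA0' : flip_digit DA N.-1 by split; [lia|rewrite subnn].
have hE' : pinched (flip A) (flip B) N.-1.
  by have := pinched_flip N0 hE; rewrite subn0.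
apply: (pinched_last_unique (digit_system_flip hA) (digit_system_flip hB)
  DA0' hE' erefl (flipK Ay) (flipK By)).
by move=> z Az Bz; have := uniqE _ Az Bz; lra.
Qed.

End DigitSystems.

(** * Contacts between pieces *)

Section Coordinates.
Variables (R : realType) (N : nat).

(* Booleans index the two axes, and the two sides 0 and 1 along an axis. *)
Definition co (ax : bool) (p : R * R) := if ax then p.2 else p.1.
Definition dg (ax : bool) (i : digit N) : nat := if ax then i.2 else i.1.
Definition pt (ax : bool) (s t : R) : R * R := if ax then (t, s) else (s, t).

Lemma co_inj p q : (forall ax, co ax p = co ax q) -> p = q.
Proof. by move: p q => [p1 p2] [q1 q2] H; have := H true; have := H false => /= -> ->. Qed.

Lemma dg_inj i j : (forall ax, dg ax i = dg ax j) -> i = j.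
Proof.
move: i j => [i1 i2] [j1 j2] H; congr pair; apply: val_inj.
  exact: (H false).
exact: (H true).
Qed.

Lemma dg_lt ax i : (dg ax i < N)%N.
Proof. by case: ax; exact: ltn_ord. Qed.

Lemma co_pt ax s t : co ax (pt ax s t) = s.
Proof. by case: ax. Qed.

Lemma co_pt_perp ax s t : co (~~ ax) (pt ax s t) = t.
Proof. by case: ax. Qed.

Lemma pt_co ax p : pt ax (co ax p) (co (~~ ax) p) = p.
Proof. by case: ax p => [] []. Qed.

Lemma forall_axes (P : bool -> Prop) ax : P ax -> P (~~ ax) -> forall x, P x.
Proof. by case: ax => ? ? []. Qed.

Lemma phiP (N_gt1 : (1 < N)%N) i p q : phi i p = q <->
  forall ax, co ax q * N%:R = co ax p + (dg ax i)%:R.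
Proof.
have NN := natr_neq0 R N_gt1.
split=> [<- []|H] /=; rewrite ?divfK //.
apply: co_inj => ax; apply: (mulIf NN); rewrite H.
by case: ax; rewrite /= divfK.
Qed.

End Coordinates.

Section Contacts.
Variables (R : realType) (N : nat) (D : {set digit N}) (F : set (R * R)).
Hypothesis N_gt1 : (1 < N)%N.
Hypothesis F01 : forall p ax, F p -> 0 <= co ax p <= 1.
Hypothesis FE : F = Uimg D F.

Definition in_piece (i : digit N) (p : R * R) :=
  exists2 q, F q & forall ax, co ax p * N%:R = co ax q + (dg ax i)%:R.

Lemma in_pieceP i p : in_piece i p <-> (phi i @` F) p.
Proof.
split=> [[q Fq e]|[q Fq e]]; exists q => //; first exact/phiP.
by apply/phiP.
Qed.

Lemma attractorP p : F p <-> exists2 i, i \in D & in_piece i p.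
Proof.
split.
  by rewrite {1}FE => -[i /= iD /in_pieceP H]; exists i.
by move=> [i iD /in_pieceP H]; rewrite FE; exists i.
Qed.

(** Only pieces with the extreme digit [s * N.-1], that is 0 or N - 1, reach side [s], and they do
    so along their own side [s]. Hence the sides of [F] are digit systems. *)
Lemma in_piece_side (i : digit N) p ax (s : bool) q : F q -> co ax p = s%:R ->
  co ax p * N%:R = co ax q + (dg ax i)%:R ->
  dg ax i = (s * N.-1)%N /\ co ax q = s%:R.
Proof.
move=> Fq -> e; have qb := F01 ax Fq; have dN := dg_lt ax i.
case: s e => e.
- rewrite mul1r in e; rewrite mul1n.
  have h : 0 <= (1 : R) <= 1 by rewrite ler01 lexx.
  have e' : 1 + N.-1%:R = co ax q + (dg ax i)%:R.
    by rewrite -e addrC natr1 prednK //; lia.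
  have [[<- <-] //|[dE _ _]|[_ /eqP]] := carry h qb e'; first by lia.
  by rewrite oner_eq0.
- have d0 : 0 <= (dg ax i)%:R :> R by [].
  have /andP[q0 _] := qb; have e' : 0 * N%:R = co ax q + (dg ax i)%:R := e.
  rewrite mul0r in e'; rewrite mul0n; split; last by change (co ax q = 0); lra.
  by apply/eqP; rewrite -(@eqr_nat R); apply/eqP; lra.
Qed.

Definition edge ax (s : bool) (t : R) := F (pt ax s%:R t).
Definition edge_digit ax (s : bool) (r : nat) :=
  exists i, [/\ i \in D, dg ax i = (s * N.-1)%N & dg (~~ ax) i = r].

Lemma edge_system ax s : digit_system N (edge ax s) (edge_digit ax s).
Proof.
split.
- by move=> t /(F01 (~~ ax)); rewrite co_pt_perp.
- by move=> r [i [_ _ <-]]; exact: dg_lt.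
- move=> t; split.
  + move=> /attractorP [i iD [q Fq e]].
    have [di qs] := in_piece_side Fq (co_pt ax s%:R t) (e ax).
    exists (dg (~~ ax) i), (co (~~ ax) q); split.
    * by exists i.
    * by rewrite /edge -qs pt_co.
    * by rewrite -(e (~~ ax)) co_pt_perp.
  + move=> [r [u [[i [iD di dr]] eu e]]]; apply/attractorP.
    exists i => //; exists (pt ax s%:R u) => //.
    apply: (forall_axes (ax := ax)); last by rewrite !co_pt_perp e dr.
    rewrite !co_pt di; case: s {eu di} => /=; last by rewrite mul0r mul0n addr0.
    by rewrite mul1r mul1n addrC natr1 prednK //; lia.
Qed.

Definition step (s : bool) (m n : nat) := if s then n = m.+1 else m = n.+1.

(* The points of [F] whose image in the cell of [a] lies in another cell. *)
Definition contact (a : digit N) (z : R * R) := F z /\ exists j q,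
  [/\ j \in D, j <> a, F q & forall ax, co ax z + (dg ax a)%:R = co ax q + (dg ax j)%:R].

Definition shared ax s t := edge ax s t /\ edge ax (~~ s) t.

Definition side_neighbour (a : digit N) ax s (j : digit N) :=
  [/\ j \in D, step s (dg ax a) (dg ax j) & dg (~~ ax) j = dg (~~ ax) a].

Variant contact_spec (a : digit N) (z : R * R) : Prop :=
| SideContact ax (s : bool) j of co ax z = s%:R & side_neighbour a ax s j
    & shared ax s (co (~~ ax) z)
| CornerContact (s : bool -> bool) j q of j \in D & F q &
    forall ax, [/\ co ax z = (s ax)%:R, co ax q = (~~ s ax)%:R
                 & step (s ax) (dg ax a) (dg ax j)].

(** Apply [carry] on each axis: no carry at all would give j = a, one carry is a contact along a
    side, and two carries are a contact at a corner. *)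
Lemma contactP a z : contact a z -> contact_spec a z.
Proof.
move=> [Fz [j [q [jD ja Fq e]]]].
have H ax : (dg ax j = dg ax a /\ co ax z = co ax q) \/
   exists s : bool, [/\ co ax z = s%:R, co ax q = (~~ s)%:R & step s (dg ax a) (dg ax j)].
  have [[? ?]|[? ? ?]|[? ? ?]] := carry (F01 ax Fz) (F01 ax Fq) (e ax).
  - by left.
  - by right; exists true.
  - by right; exists false.
have side ax : dg ax j = dg ax a -> co ax z = co ax q ->
    (exists s : bool, [/\ co (~~ ax) z = s%:R, co (~~ ax) q = (~~ s)%:R
       & step s (dg (~~ ax) a) (dg (~~ ax) j)]) -> contact_spec a z.
  move=> dE cE [s [zs qs st]]; apply: (SideContact zs (j := j)).
    by split=> //; rewrite negbK.
  split; first by rewrite /edge -zs pt_co.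
  by rewrite /edge negbK cE -qs; have := pt_co (~~ ax) q; rewrite negbK => ->.
have [[d0 c0]|[s0 e0]] := H false; have [[d1 c1]|[s1 e1]] := H true.
- by case: ja; apply: dg_inj => -[].
- by apply: (side false) => //; exists s1.
- by apply: (side true) => //; exists s0.
- apply: (@CornerContact _ _ (fun ax => if ax then s1 else s0) j q) => //.
  by case.
Qed.

Lemma contact_shared a ax s j t : side_neighbour a ax s j ->
  shared ax s t -> contact a (pt ax s%:R t).
Proof.
move=> [jD st dE] [ht1 ht2]; split=> //; exists j, (pt ax (~~ s)%:R t); split=> //.
- by move=> e; move: st; rewrite e /step; case: s {ht1 ht2}; lia.
- apply: (forall_axes (ax := ax)); last by rewrite !co_pt_perp dE.
  rewrite !co_pt; move: st; rewrite /step; case: s {ht1 ht2} => /= ->.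
    by rewrite add0r addrC natr1.
  by rewrite add0r -natr1 addrC.
Qed.

(** One contact on side [s] already puts [b] on that side; then the common part of the two opposite
    sides of [F] is pinched at the transverse digit of [b]. *)
Lemma pinched_shared a b ax s j t : side_neighbour a ax s j ->
  shared ax s t ->
  (forall z, contact a z -> in_piece b z) ->
  [/\ dg ax b = (s * N.-1)%N, b \in D -> edge_digit ax s (dg (~~ ax) b) &
      pinched N (edge ax s) (edge ax (~~ s)) (dg (~~ ax) b)].
Proof.
move=> hj ht H.
have [q Fq e] := H _ (contact_shared hj ht).
have [db qs] := in_piece_side Fq (co_pt ax s%:R t) (e ax).
split=> //; first by move=> bD; exists b.
move=> y Ay By; have [u Fu eu] := H _ (contact_shared hj (conj Ay By)).
have [_ us] := in_piece_side Fu (co_pt ax s%:R y) (eu ax).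
exists (co (~~ ax) u); first by rewrite /edge -us pt_co.
by rewrite -(eu (~~ ax)) co_pt_perp.
Qed.

(* If every contact set between [a] and a side neighbour were a single point,
   all contacts of [a] would coincide: with the corner of [b] when [b] is a
   corner digit, and otherwise because [b] lies on a single side. *)
Lemma two_shared a b z z' : b \in D ->
  contact a z -> contact a z' -> z <> z' ->
  (forall z, contact a z -> in_piece b z) ->
  exists ax s j, side_neighbour a ax s j /\
    exists p q, [/\ shared ax s p, shared ax s q & p <> q].
Proof.
move=> bD cz cz' zz' H; apply: contrapT => none.
have uniq ax s j p q : side_neighbour a ax s j -> shared ax s p -> shared ax s q -> p = q.
  move=> hj hp hq; apply: contrapT => pq; apply: none.
  by exists ax, s, j; split=> //; exists p, q.
have s_inj (s s' : bool) : (s * N.-1 = s' * N.-1)%N -> s = s'.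
  by case: s; case: s' => //; lia.
have corner (s : bool -> bool) y : (forall ax, dg ax b = (s ax * N.-1)%N) -> contact a y ->
    forall ax, co ax y = (s ax)%:R.
  move=> bs cy; have [q Fq e] := H _ cy.
  case: (contactP cy) => [ax s' j ys hj hy|s' j w _ _ ys]; last first.
    move=> ax; have [yE _ _] := ys ax.
    have [db _] := in_piece_side Fq yE (e ax).
    by rewrite yE; congr (_%:R); congr nat_of_bool; apply: s_inj; rewrite -db bs.
  have [db ed pin] := pinched_shared hj hy H.
  apply: (forall_axes (ax := ax)).
    by rewrite ys; congr (_%:R); congr nat_of_bool; apply: s_inj; rewrite -db bs.
  have un t : edge ax s' t -> edge ax (~~ s') t -> t = co (~~ ax) y.
    by move=> h1 h2; apply: (uniq ax s' j).
  have := bs (~~ ax); case: (s (~~ ax)) => /= bE.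
    apply: (pinched_last_unique N_gt1 (edge_system ax s') (edge_system ax (~~ s'))
      (ed bD) pin _ hy.1 hy.2 un).
    by rewrite bE mul1n.
  rewrite bE mul0n in ed pin.
  exact: (pinched_first_unique N_gt1 (edge_system ax s') (edge_system ax (~~ s'))
      (ed bD) pin hy.1 hy.2 un).
have all_eq (s : bool -> bool) : (forall ax, dg ax b = (s ax * N.-1)%N) -> z = z'.
  by move=> bs; apply: co_inj => ax; rewrite (corner s z) // (corner s z').
(* A corner contact inside piece [b] makes [b] a corner digit. *)
have diag y (s : bool -> bool) j w : contact a y -> j \in D -> F w ->
   (forall ax, [/\ co ax y = (s ax)%:R, co ax w = (~~ s ax)%:R
                 & step (s ax) (dg ax a) (dg ax j)]) -> z = z'.
  move=> cy _ _ ys; apply: (all_eq s) => ax.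
  have [q Fq e] := H _ cy.
  have [yE _ _] := ys ax.
  by have [] := in_piece_side Fq yE (e ax).
have [q Fq e] := H _ cz; have [q' Fq' e'] := H _ cz'.
apply: zz'.
case: (contactP cz) => [ax s j zs hj hz|s j w jD Fw zs]; last exact: (diag z s j w).
case: (contactP cz') => [ax' s' j' zs' hj' hz'|s' j' w jD Fw zs']; last exact: (diag z' s' j' w).
have [db _] := in_piece_side Fq zs (e ax).
have [db' _] := in_piece_side Fq' zs' (e' ax').
have [eax|nax] := eqVneq ax' ax.
  have es : s' = s by apply: s_inj; rewrite -db -db' eax.
  rewrite eax es in hz' zs'.
  apply: co_inj; apply: (forall_axes (ax := ax)); first by rewrite zs zs'.
  exact: (uniq ax s j).
(* Contacts on sides along both axes also make [b] a corner digit. *)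
apply: (all_eq (fun x => if x == ax then s else s')).
apply: (forall_axes (ax := ax)); first by rewrite eqxx.
have -> : ~~ ax = ax' by case: ax ax' nax {zs hj hz zs' hj' hz' db db'} => [] [].
by rewrite (negbTE nax).
Qed.

Hypothesis two_contacts : forall a, a \in D ->
  exists z z', [/\ contact a z, contact a z' & z <> z'].

Lemma contact_not_in_subpiece a b c : a \in D -> b \in D ->
  (forall z, contact a z -> in_piece b z) ->
  ~ (forall z, contact a z -> exists q,
      [/\ F q, forall ax, co ax z * N%:R = co ax q + (dg ax b)%:R & in_piece c q]).
Proof.
move=> aD bD H H2; have [z [z' [cz cz' zz']]] := two_contacts aD.
have [ax [s [j [hj [p [q [hp hq pq]]]]]]] := two_shared bD cz cz' zz' H.
have [db ed pin] := pinched_shared hj hp H.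
apply: (pinched_subpiece N_gt1 (edge_system ax s) (edge_system ax (~~ s))
   (ed bD) pin hp.1 hp.2 hq.1 hq.2 pq (dg_lt (~~ ax) c)).
move=> y Ay By; have [u [Fu eu [v Fv ev]]] := H2 _ (contact_shared hj (conj Ay By)).
have [_ us] := in_piece_side Fu (co_pt ax s%:R y) (eu ax).
have [_ vs] := in_piece_side Fv us (ev ax).
exists (co (~~ ax) u), (co (~~ ax) v); split.
- by rewrite /edge -us pt_co.
- by rewrite /edge -vs pt_co.
- by rewrite -(eu (~~ ax)) co_pt_perp.
- exact: ev.
Qed.

(** Here [b] lies on a side [s]. Once side contacts of [b] are excluded, its contacts are corners on
    the side opposite to [s], and two of them contradict [pinched_ends]. *)
Lemma contact_not_nested a b c : a \in D -> b \in D -> c \in D ->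
  (forall z, contact a z -> in_piece b z) ->
  ~ (forall z, contact b z -> in_piece c z).
Proof.
move=> aD bD cD H H2; have [z [z' [cz cz' zz']]] := two_contacts aD.
have [ax [s [j [hj [p [q [hp hq pq]]]]]]] := two_shared bD cz cz' zz' H.
have [db ed pin] := pinched_shared hj hp H.
have hA := edge_system ax s; have hB := edge_system ax (~~ s).
have out (i : digit N) : ~ step s (dg ax b) (dg ax i).
  rewrite db /step; have := dg_lt ax i.
  by case: (s) => /=; lia.
have spec y : contact b y -> exists t : bool,
    [/\ y = pt ax (~~ s)%:R t%:R, edge ax (~~ s) t%:R & edge ax s (~~ t)%:R].
  move=> cy; case: (contactP cy) => [ax1 s1 i ys hi hy|s1 i w iD Fw ys].
    exfalso; have [eax|nax] := eqVneq ax1 ax.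
      rewrite eax in ys hi hy; have [es|ns] := eqVneq s1 s.
        by case: hi => _; rewrite es => /out.
      have es : s1 = ~~ s by case: (s1) (s) ns => [] [].
      (* A neighbour of [b] away from [s] would confine the common points to a piece of the side
         opposite to [s]. *)
      rewrite es in ys hi hy; have [dc ec pc] := pinched_shared hi hy H2.
      apply: (pinched_B_piece N_gt1 hA hB (ed bD) pin hp.1 hp.2 hq.1 hq.2 pq (ec cD)).
      by move=> u Au Bu; apply: pc => //; rewrite negbK.
    have eax : ax1 = ~~ ax by case: (ax1) (ax) nax => [] [].
    rewrite eax in hi; case: hi => iD st; rewrite negbK => dE.
    (* A neighbour along the other axis also lies on side [s], with a digit adjacent to that of
       [b]. *)
    apply: (pinched_A_adjacent N_gt1 hA hB (ed bD) pin hp.1 hp.2 hq.1 hq.2 pq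
      (c := dg (~~ ax) i)).
      by move: st; rewrite /step; case: (s1) => ?; [right|left].
    by exists i; rewrite dE.
  have [yE wE st] := ys ax; have [yE' wE' _] := ys (~~ ax).
  have es : s1 ax = ~~ s.
    have [es|] := eqVneq (s1 ax) s; last by case: (s1 ax) (s) => [] [].
    by rewrite es in st; case: (out i).
  rewrite es in yE wE; rewrite negbK in wE.
  have Fy : F y by case: cy.
  exists (s1 (~~ ax)); split.
  - by rewrite -yE -yE' pt_co.
  - by rewrite /edge -yE -yE' pt_co.
  - by rewrite /edge -wE -wE' pt_co.
have [y [y' [cy cy' yy']]] := two_contacts bD.
have [t [yt ht1 ht2]] := spec _ cy; have [t' [yt' ht1' ht2']] := spec _ cy'.
(* Two different contacts use both corners, so that all four corners of the square belong to [F]. *)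
have tt' : t' = ~~ t.
  by case: t t' yt yt' {ht1 ht2 ht1' ht2'} => [] [] // yt yt'; case: yy'; rewrite yt yt'.
apply: (pinched_ends N_gt1 hA pin); rewrite tt' in ht1' ht2'.
by case: t ht1 ht2 ht1' ht2' {yt tt'} => /= *.
Qed.

End Contacts.

(** * Cells *)

Section ConnectedSets.
Variable T : topologicalType.
Implicit Types A U V C K : set T.

Lemma connected_open_split A U V : connected A -> open U -> open V ->
  A `<=` U `|` V -> (forall p, A p -> U p -> V p -> False) ->
  A `&` U !=set0 -> A `<=` U.
Proof.
move=> cA oU oV sub dis ne.
have e : A `&` U = A.
  apply: cA => //; first by exists U.
  exists (~` V); first exact: open_closedC.
  apply/seteqP; split=> p [Ap].
    by move=> Up; split=> // Vp; exact: (dis p).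
  by move=> nV; split=> //; case: (sub p Ap).
by rewrite -e => p [].
Qed.

Lemma connected_closed_split A C K : connected A -> closed C -> closed K ->
  A `<=` C `|` K -> (forall p, A p -> C p -> K p -> False) ->
  A `&` C !=set0 -> A `<=` C.
Proof.
move=> cA oC oK sub dis ne.
have e : A `&` C = A.
  apply: cA => //; last by exists C.
  exists (~` K); first exact: closed_openC.
  apply/seteqP; split=> p [Ap].
    by move=> Up; split=> // Vp; exact: (dis p).
  by move=> nV; split=> //; case: (sub p Ap).
by rewrite -e => p [].
Qed.

End ConnectedSets.

(** * Words and grid positions *)

Section Words.
Variables (R : realType) (N : nat).
Hypothesis N_gt1 : (1 < N)%N.
Implicit Types (w u v : seq (digit N)) (p q : R * R).

Lemma phiw_cat u v p : phiw (u ++ v) p = phiw u (phiw v p).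
Proof. by elim: u => //= i u IH; rewrite IH. Qed.

(** The base-N number with digits [dg ax]: the position of the cell of [w] in the grid of mesh N^-k,
    where k is the length of [w]. *)
Fixpoint grid (ax : bool) w : nat :=
  if w is i :: w' then (dg ax i * N ^ size w' + grid ax w')%N else 0%N.

Lemma co_phiw w p ax :
  co ax (phiw w p) * N%:R ^+ size w = co ax p + (grid ax w)%:R.
Proof.
elim: w => [|i w IH] /=; first by rewrite mulr1 addr0.
have /(_ ax) e := (phiP N_gt1 i (phiw w p) (phi i (phiw w p))).1 erefl.
by rewrite exprS mulrA e mulrDl IH natrD natrM natrX; lra.
Qed.

Lemma phiw_inj w : injective (phiw w : R * R -> R * R).
Proof.
move=> p q e; apply: co_inj => ax.
by have := co_phiw w p ax; have := co_phiw w q ax; rewrite e; lra.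
Qed.

Lemma grid_lt ax w : (grid ax w < N ^ size w)%N.
Proof.
elim: w => [|i w IH] //=; have := dg_lt ax i; rewrite expnS.
move: IH; move: (N ^ size w)%N (grid _ _) (dg ax i) => a b c; nia.
Qed.

Lemma grid_inj u v : size u = size v -> (forall ax, grid ax u = grid ax v) -> u = v.
Proof.
elim: u v => [|i u IH] [|j v] //= [e] H.
have Nk : (0 < N ^ size v)%N by rewrite expn_gt0; lia.
have E ax : dg ax i = dg ax j /\ grid ax u = grid ax v.
  have := H ax; have := grid_lt ax u; have := grid_lt ax v; rewrite e.
  move: Nk; move: (N ^ size v)%N (grid _ u) (grid _ v) (dg ax i) (dg ax j).
  move=> a b c x y _ cb ba e'.
  by have := congr1 (edivn^~ a) e'; rewrite !edivn_eq // => -[].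
congr cons; first by apply: dg_inj => ax; case: (E ax).
by apply: IH => // ax; case: (E ax).
Qed.

Lemma phi_continuous (i : digit N) : continuous (phi i : R * R -> R * R).
Proof.
move=> p.
have h1 : (fun x : R * R => (x.1 + (i.1 : nat)%:R) / N%:R) x @[x --> p] -->
    (p.1 + (i.1 : nat)%:R) / N%:R.
  by apply: cvgM; [apply: cvgD; [exact: cvg_fst|exact: cvg_cst]|exact: cvg_cst].
have h2 : (fun x : R * R => (x.2 + (i.2 : nat)%:R) / N%:R) x @[x --> p] -->
    (p.2 + (i.2 : nat)%:R) / N%:R.
  by apply: cvgM; [apply: cvgD; [exact: cvg_snd|exact: cvg_cst]|exact: cvg_cst].
exact: (cvg_pair h1 h2).
Qed.

Lemma phiw_continuous w : continuous (phiw w : R * R -> R * R).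
Proof.
elim: w => [|i w IH]; first by move=> p; exact: cvg_id.
by move=> p; apply: continuous_comp; [exact: IH|exact: phi_continuous].
Qed.

End Words.

Section Attractor.
Variables (R : realType) (N : nat) (D : {set digit N}) (F : set (R * R)).
Hypothesis N_gt1 : (1 < N)%N.
Hypothesis att : is_attractor D F.
Implicit Types (w u v : seq (digit N)) (p q : R * R).

Lemma attractorE : F = Uimg D F. Proof. by case: att. Qed.

(** Each point has preimages in [F] of every order; a coordinate outside [0, 1] would move away
    geometrically along them, against boundedness. *)
Lemma attractor_unit p ax : F p -> 0 <= co ax p <= 1.
Proof.
have [_ cF _] := att; have N2 := natr_ge2 R N_gt1.
have [M FM] : exists M : R, forall p, F p -> `|co ax p| <= M.
  have /ex_strict_bound_gt0 [M _ hM] := compact_bounded cF.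
  exists M => q /hM /ltW; apply: le_trans; rewrite prod_normE.
  by case: (ax); rewrite le_max lexx ?orbT.
have pre q : F q -> exists (i : digit N) q', F q' /\ co ax q * N%:R = co ax q' + (dg ax i)%:R.
  by move=> /(attractorP N_gt1 attractorE)[i _ [q' Fq' e]]; exists i, q'.
move=> Fp; apply/andP; split.
- rewrite -oppr_le0; apply: (geometric_le0 N_gt1 (C := M)) => k.
  elim: k p Fp => [|k IH] p Fp.
    by have := FM _ Fp; rewrite ler_norml mulr1 => /andP[]; lra.
  have [i [q [Fq e]]] := pre _ Fp.
  apply: le_trans (IH _ Fq); rewrite exprS mulrA ler_wpM2r ?exprn_ge0 //.
  by have : 0 <= (dg ax i)%:R :> R by []; lra.
- rewrite -subr_le0; apply: (geometric_le0 N_gt1 (C := M)) => k.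
  elim: k p Fp => [|k IH] p Fp.
    by have := FM _ Fp; rewrite ler_norml mulr1 => /andP[]; lra.
  have [i [q [Fq e]]] := pre _ Fp.
  apply: le_trans (IH _ Fq); rewrite exprS mulrA ler_wpM2r ?exprn_ge0 //.
  by have := dg_lt ax i; rewrite -(ler_nat R) -natr1; lra.
Qed.

Definition cell w : set (R * R) := phiw w @` F.

Definition word (k : nat) w := size w = k /\ all (fun i => i \in D) w.

Lemma cell_cat u v : cell (u ++ v) = phiw u @` cell v.
Proof.
apply/seteqP; split=> p.
  by move=> [q Fq <-]; exists (phiw v q); [exists q|rewrite phiw_cat].
by move=> [_ [q Fq <-] <-]; exists q; rewrite ?phiw_cat.
Qed.

Lemma cell_sub w : all (fun i => i \in D) w -> cell w `<=` F.
Proof.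
elim: w => [|i w IH] /= => [_ p [q Fq <-] //|/andP[iD wD] p [q Fq <-]].
rewrite attractorE; exists i => //=; exists (phiw w q) => //.
by apply: IH => //; exists q.
Qed.

Lemma cell_cat_sub u v : all (fun i => i \in D) v -> cell (u ++ v) `<=` cell u.
Proof.
by move=> vD; rewrite cell_cat => _ [q /(cell_sub vD) Fq <-]; exists q.
Qed.

Lemma cell_cover k p : F p -> exists2 w, word k w & cell w p.
Proof.
elim: k p => [|k IH] p Fp; first by exists [::] => //; exists p.
move: Fp; rewrite {1}attractorE => -[i /= iD [q Fq <-]].
have [w [sw wD] [r Fr e]] := IH _ Fq.
by exists (i :: w); [split=> /=; rewrite ?sw ?iD|exists r => //=; rewrite e].
Qed.

Lemma cell_refine u m p : cell u p ->
  exists2 v, word m v & cell (u ++ v) p.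
Proof.
move=> [q Fq <-]; have [v wv cv] := cell_cover m Fq.
by exists v => //; rewrite cell_cat; exists q.
Qed.

Lemma cell_compact w : compact (cell w).
Proof.
have [_ cF _] := att; apply: continuous_compact => //.
by apply: continuous_subspaceT; exact: phiw_continuous.
Qed.

Lemma cell_closed w : closed (cell w).
Proof. by apply: compact_closed; [exact: norm_hausdorff|exact: cell_compact]. Qed.

Lemma cell_neq0 w : cell w !=set0.
Proof. by have [[p Fp] _ _] := att; exists (phiw w p); exists p. Qed.

Lemma cell_connected w : connected F -> connected (cell w).
Proof.
move=> cF; apply: connected_continuous_connected => //.
by apply: continuous_subspaceT; exact: phiw_continuous.
Qed.

Lemma cell_diam w p q ax : cell w p -> cell w q ->
  `|co ax p - co ax q| * N%:R ^+ size w <= 1.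
Proof.
move=> [p' Fp' <-] [q' Fq' <-].
rewrite -[X in _ * X]ger0_norm ?exprn_ge0 // -normrM mulrBl !co_phiw //.
have /andP[? ?] := attractor_unit ax Fp'; have /andP[? ?] := attractor_unit ax Fq'.
by rewrite ler_norml; apply/andP; split; lra.
Qed.

Lemma word_tuple k w : word k w -> exists2 t, t \in verts D k & tval t = w.
Proof.
move=> [sw wD]; exists (Tuple (introT eqP sw)) => //.
by rewrite inE.
Qed.

Lemma verts_word k (t : k.-tuple (digit N)) : t \in verts D k -> word k t.
Proof. by rewrite inE => tD; split=> //; rewrite size_tuple. Qed.

(* Grid positions of cells of level k near a common point differ by at most 3
   in each coordinate, so they are determined by their residues modulo 4. *)
Lemma card_near k (S : {set k.-tuple (digit N)}) x :
  (forall t, t \in S -> exists2 p, cell t p &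
     forall ax, `|co ax p - co ax x| * N%:R ^+ k <= 1) -> (#|S| <= 16)%N.
Proof.
move=> near; pose f (t : k.-tuple (digit N)) : 'I_4 * 'I_4 :=
  (inord (grid false t %% 4), inord (grid true t %% 4)).
have f_inj : {in S &, injective f}.
  move=> t t' tS t'S [e0 e1]; apply: val_inj; apply: grid_inj; rewrite ?size_tuple //.
  have close ax : (grid ax t <= grid ax t' + 3)%N /\ (grid ax t' <= grid ax t + 3)%N.
    have [_ [q Fq <-] hq] := near _ tS; have [_ [q' Fq' <-] hq'] := near _ t'S.
    have := hq ax; have := hq' ax.
    have := co_phiw N_gt1 t q ax; have := co_phiw N_gt1 t' q' ax.
    rewrite !size_tuple => E E'.
    have norm_scale (a m : R) : 0 <= m -> `|a| * m <= 1 -> -1 <= a * m <= 1.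
      by move=> m0; rewrite -{1}(ger0_norm m0) -normrM ler_norml.
    have m0 : 0 <= N%:R ^+ k :> R by rewrite exprn_ge0.
    have /andP[? ?] := attractor_unit ax Fq; have /andP[? ?] := attractor_unit ax Fq'.
    move=> /(norm_scale _ _ m0) /andP[? ?] /(norm_scale _ _ m0) /andP[? ?].
    by split; rewrite -(ler_nat R) natrD; lra.
  have md ax : (grid ax t %% 4 = grid ax t' %% 4)%N.
    case: ax.
      by move/(congr1 val): e1; rewrite /= !inordK ?ltn_pmod.
    by move/(congr1 val): e0; rewrite /= !inordK ?ltn_pmod.
  move=> ax; change (grid ax (tval t) = grid ax (tval t')).
  by move: (grid ax t) (grid ax t') (close ax) (md ax) => a b; lia.
rewrite -(card_in_imset f_inj); apply: (leq_trans (max_card _)).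
by rewrite card_prod !card_ord.
Qed.

End Attractor.

(** * Components of the level graphs *)

(** Positivity of [c] neutralises the default value 0 of [nth] on lists with fewer than two
    entries. *)
Lemma second_sortedP (s : seq nat) (c : nat) : (0 < c)%N ->
  (c <= nth 0%N (sort geq s) 1)%N = (1 < count (leq c) s)%N.
Proof.
move=> c0; rewrite -(permP (permEl (perm_sort geq s))).
have : sorted geq (sort geq s) by apply: sort_sorted => m n; exact: leq_total.
case: (sort geq s) => [|x [|y l]] /=; first by rewrite leqNgt c0.
  by rewrite leqNgt c0 => _; case: (c <= x)%N.
move=> /andP[yx hl]; have ly : all (fun z => z <= y)%N l.
  by apply: order_path_min hl => a b d ba da; exact: leq_trans ba.
have [cy|yc] := leqP c y; first by rewrite (leq_trans cy yx).
rewrite add0n; have -> : count (leq c) l = 0%N.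
  apply/eqP; rewrite -leqn0 leqNgt -has_count -all_predC.
  apply: sub_all ly => z zy /=; rewrite -ltnNge.
  exact: leq_ltn_trans yc.
by rewrite addn0; case: (c <= x)%N.
Qed.

Lemma count_enum (T : finType) (S : {set T}) (P : pred T) :
  count P (fintype.enum S) = #|[set x in S | P x]|.
Proof.
rewrite cardE /enum_mem size_filter count_filter; apply: eq_count => x /=.
by rewrite !inE andbC.
Qed.

Section Components.
Variables (T : finType) (V : {set T}) (e : rel T).

Lemma chi_geP (c : nat) : (0 < c)%N -> (c <= chi V e)%N <->
  exists v C C', [/\ v \in V, C \in components e (V :\ v),
    C' \in components e (V :\ v), C != C' & (c <= #|C|)%N /\ (c <= #|C'|)%N].
Proof.
move=> c0; split.
- move=> hc; have : ~~ (chi V e <= c.-1)%N by rewrite -ltnNge prednK.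
  apply: contraNP => none; apply/bigmax_leqP => v /andP[vV _].
  rewrite leqNgt prednK //; apply/negP.
  rewrite second_sortedP // count_map (count_enum _ (preim _ _)) => /card_gt1P[C [C' [hC hC' CC']]].
  apply: none; exists v, C, C'.
  by move: hC hC'; rewrite !inE => /andP[? ?] /andP[? ?].
- move=> [v [C [C' [vV hC hC' CC' [cC cC']]]]].
  apply: (leq_trans (n := second_largest V e v)).
    rewrite second_sortedP // count_map (count_enum _ (preim _ _)).
    by apply/card_gt1P; exists C, C'; rewrite !inE hC hC' /= cC cC'.
  apply: leq_bigmax_cond; rewrite vV /=; apply/andP; split=> //.
  by apply/card_gt1P; exists C, C'.
Qed.

Hypothesis e_sym : symmetric e.
Variable W : {set T}.

Lemma restr_connect_sym : connect_sym (restr e W).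
Proof. by apply: sym_connect_sym => x y; rewrite /restr e_sym andbCA. Qed.

Definition component x := [set y in W | connect (restr e W) x y].

Lemma component_closed x y z : y \in component x -> z \in W -> e y z ->
  z \in component x.
Proof.
rewrite !inE => /andP[yW xy] zW yz; rewrite zW /=.
by apply: connect_trans xy _; apply: connect1; rewrite /restr yW zW.
Qed.

Lemma component_mem x : x \in W -> x \in component x.
Proof. by move=> xW; rewrite inE xW connect0. Qed.

Lemma component_eq x y : y \in component x -> component x = component y.
Proof.
rewrite inE => /andP[yW xy]; apply/setP => z; rewrite !inE; congr (_ && _).
exact: (same_connect restr_connect_sym).
Qed.

Lemma component_in x : x \in W -> component x \in components e W.
Proof. by move=> xW; apply/imsetP; exists x. Qed.

Lemma component_inv (P : T -> Prop) x : (forall y z, y \in W -> z \in W -> e y z -> P y -> P z) ->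
  P x -> forall y, y \in component x -> P y.
Proof.
move=> H Px y; rewrite inE => /andP[_ /connectP[p hp ->]].
elim: p x Px hp => //= z p IH x Px /andP[/and3P[xW zW xz] hp].
exact: IH (H _ _ xW zW xz Px) hp.
Qed.

End Components.

Lemma card_verts N (D : {set digit N}) k : #|verts D k| = (#|D| ^ k)%N.
Proof.
elim: k => [|k IH].
  rewrite expn0; apply/eqP/cards1P; exists [tuple]; apply/setP => t.
  by rewrite !inE tuple0.
pose f (x : digit N * k.-tuple (digit N)) := cons_tuple x.1 x.2.
have f_inj : injective f.
  by move=> [i t] [j u] /(congr1 val) [/= -> /val_inj ->].
have -> : verts D k.+1 = f @: finset.setX D (verts D k).
  apply/setP => t; apply/idP/imsetP.
    case/tupleP: t => i t; rewrite inE /= => /andP[iD tD].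
    by exists (i, t) => //; rewrite !inE /= iD.
  move=> [[i u]]; rewrite !inE /= => /andP[iD uD] ->.
  by rewrite /= iD.
by rewrite card_imset // cardsX IH expnS.
Qed.

Section LevelGraph.
Variables (R : realType) (N : nat) (D : {set digit N}) (F : set (R * R)).
Hypothesis N_gt1 : (1 < N)%N.
Hypothesis att : is_attractor D F.
Variable k : nat.
Implicit Types (S W : {set k.-tuple (digit N)}).

Lemma gedge_sym : symmetric (gedge F k : rel (k.-tuple (digit N))).
Proof.
by move=> s t; rewrite /gedge eq_sym; congr (_ && _); rewrite setIC.
Qed.

Lemma gedgeP (s t : k.-tuple (digit N)) p : s != t -> cell F s p -> cell F t p -> gedge F k s t.
Proof. by move=> st sp tp; rewrite /gedge st; apply/asboolP; exists p. Qed.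

Definition cells S : set (R * R) := \bigcup_(t in [set t | t \in S]) cell F t.

Lemma cells_closed S : closed (cells S).
Proof. by apply: closed_bigcup => // t _; exact: (cell_closed att). Qed.

Lemma component_cells_disjoint W x (t : k.-tuple (digit N)) p : t \in W ->
  t \notin component (gedge F k) W x -> cell F t p ->
  ~ cells (component (gedge F k) W x) p.
Proof.
move=> tW tC tp [u /= uC up]; case/negP: (tC).
apply: (component_closed uC tW); apply: (gedgeP _ up tp).
by apply: contraNneq tC => <-.
Qed.

(** Cells that meet are joined by an edge, so a component and the rest of [W] occupy disjoint closed
    sets, and a connected set cannot straddle them. *)
Lemma component_absorbs W x (A : set (R * R)) : connected A ->
  A `<=` cells W ->
  A `&` cells (component (gedge F k) W x) !=set0 ->
  A `<=` cells (component (gedge F k) W x).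
Proof.
move=> cA sub ne; pose C := component (gedge F k) W x.
refine (connected_closed_split cA (@cells_closed C) (@cells_closed (W :\: C)) _ _ ne).
  move=> p /sub [t /= tW tp]; have [tC|tC] := boolP (t \in C).
    by left; exists t.
  by right; exists t => //=; rewrite inE tC.
move=> p _ Cp [t /=]; rewrite inE => /andP[tC tW] tp.
exact: (component_cells_disjoint tW tC tp).
Qed.

Lemma cells_in_component W S x : S \subset W -> x \in S -> connected (cells S) ->
  S \subset component (gedge F k) W x.
Proof.
move=> /fintype.subsetP SW xS cS; apply/fintype.subsetP => t tS.
have sub : cells S `<=` cells (component (gedge F k) W x).
  apply: component_absorbs => //.
    by move=> p [u /= uS up]; exists u => //; exact: SW.
  have [p xp] := cell_neq0 att x; exists p; split; first by exists x.
  by exists x => //=; apply/component_mem/SW.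
apply: contrapT => /negP tC; have [p tp] := cell_neq0 att t.
by apply: (component_cells_disjoint (SW _ tS) tC tp); apply: sub; exists t.
Qed.

End LevelGraph.

(** * Cut vertices with two large components *)

Section CutVertices.
Variables (R : realType) (N : nat) (D : {set digit N}) (F : set (R * R)).
Hypothesis D_gt1 : (1 < #|D|)%N.
Hypothesis att : is_attractor D F.

(** The words extending those in [S] number at most 16 |D|^k, fewer than |D|^(5 + k) because 2^5 >
    16. This is why level 6 is used. *)
Lemma large_set_escapes k (C : {set (6 + k).-tuple (digit N)})
    (S : {set 6.-tuple (digit N)}) :
  C \subset verts D (6 + k) -> (#|D| ^ (6 + k).-1 <= #|C|)%N -> (#|S| <= 16)%N ->
  exists u t, [/\ u \in verts D 6, u \notin S, t \in C & cell F t `<=` cell F u].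
Proof.
move=> /fintype.subsetP CV cC cS; apply: contrapT => none.
pose f (x : 6.-tuple (digit N) * k.-tuple (digit N)) := cat_tuple x.1 x.2.
have sub : C \subset f @: finset.setX S (verts D k).
  apply/fintype.subsetP => t tC; have [st tD] := verts_word (CV _ tC).
  move: tD; rewrite -{1}(cat_take_drop 6 t) all_cat => /andP[t1 t2].
  have [|u uV ut] := @word_tuple _ D 6 (take 6 t).
    by split=> //; rewrite size_take size_tuple /= ; case: ltnP => //; lia.
  have [|w wV wt] := @word_tuple _ D k (drop 6 t).
    by split=> //; rewrite size_drop size_tuple; lia.
  have e : t = f (u, w) by apply: val_inj; rewrite /= ut wt cat_take_drop.
  apply/imsetP; exists (u, w) => //; rewrite finset.in_setX /= wV andbT.
  apply: contrapT => /negP uS; apply: none; exists u, t; split=> //.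
  by rewrite e /=; apply: (cell_cat_sub att); rewrite wt.
have := leq_trans (subset_leq_card sub) (leq_imset_card _ _).
rewrite cardsX card_verts => le1.
have le2 := leq_trans (leq_trans cC le1) (leq_mul cS (leqnn _)).
have e : (6 + k).-1 = (5 + k)%N by [].
rewrite e expnD leq_pmul2r in le2; last by rewrite expn_gt0; lia.
have : (2 ^ 5 <= #|D| ^ 5)%N by rewrite leq_exp2r.
by move=> /leq_trans /(_ le2).
Qed.

(** What the limit argument retains of a cut vertex [v]: [A] is the union of the cells of one large
    component, and the last two clauses say that neither [A] nor what lies outside it is hidden by
    16 cells of level 6. *)
Definition splitting_cell k (v : seq (digit N)) (A : set (R * R)) :=
  [/\ word D k v,
      forall X, connected X -> X `<=` F -> (forall p, X p -> ~ cell F v p) ->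
        X `&` A !=set0 -> X `<=` A,
      forall S : {set 6.-tuple (digit N)}, (#|S| <= 16)%N ->
        exists2 u, u \in verts D 6 & u \notin S /\ cell F u `&` A !=set0 &
      forall S : {set 6.-tuple (digit N)}, (#|S| <= 16)%N ->
        exists2 u, u \in verts D 6 & u \notin S /\ ~ (cell F u `<=` A)].

Lemma splitting_cell_exists k : (6 <= k)%N ->
  (#|D| ^ k.-1 <= chiGamma D F k)%N -> exists v A, splitting_cell k v A.
Proof.
move=> /subnKC <-; move: (k - 6)%N => {}k.
rewrite /chiGamma => /chi_geP []; first by rewrite expn_gt0; lia.
move=> v [C [C' [vV hC hC' CC' [cC cC']]]].
pose W := verts D (6 + k) :\ v.
have WV : W \subset verts D (6 + k) by exact: subD1set.
case/imsetP: hC CC' cC => x xW; rewrite -/(component _ W x) => -> CC' cC.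
case/imsetP: hC' CC' cC' => y yW; rewrite -/(component _ W y) => -> CC' cC'.
have CW z : component (gedge F (6 + k)) W z \subset verts D (6 + k).
  apply: fintype.subset_trans WV; apply/fintype.subsetP => t; rewrite inE.
  by case/andP.
exists v, (cells F (component (gedge F (6 + k)) W x)); split.
- exact: verts_word.
- move=> X cX XF Xv ne; apply: (component_absorbs att cX _ ne).
  move=> p Xp; have [w ww wp] := cell_cover att (6 + k) (XF _ Xp).
  have [t tV tw] := word_tuple ww; exists t; rewrite /= ?tw //.
  rewrite in_setD1 tV andbT; apply/eqP => e; apply: (Xv p) => //.
  by rewrite -e tw.
- move=> S cS; have [u [t [uV uS tC tu]]] := large_set_escapes (CW x) cC cS.
  exists u => //; split=> //; have [p tp] := cell_neq0 att t.
  by exists p; split; [exact: tu|exists t].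
- move=> S cS; have [u [t [uV uS tC tu]]] := large_set_escapes (CW y) cC' cS.
  exists u => //; split=> // sub; have [p tp] := cell_neq0 att t.
  have tW : t \in W by move: tC; rewrite inE => /andP[].
  have tn : t \notin component (gedge F (6 + k)) W x.
    apply: contraNN CC' => tx; apply/eqP.
    by rewrite (component_eq (@gedge_sym _ _ _ _) tx) (component_eq (@gedge_sym _ _ _ _) tC).
  exact: (component_cells_disjoint tW tn tp (sub _ (tu _ tp))).
Qed.

End CutVertices.

(** * Limits of cut vertices *)

Lemma connected_locally_constant (T : topologicalType) (A P : set T) :
  connected A ->
  (forall p, A p -> exists B, [/\ open B, B p & forall z, A z -> B z -> P z <-> P p]) ->
  forall p q, A p -> A q -> P p -> P q.
Proof.
move=> cA loc p q Ap Aq Pp.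
pose U (Q : set T) := \bigcup_(B in [set B | open B /\ forall z, A z -> B z -> Q z]) B.
have U_open Q : open (U Q) by apply: bigcup_open => B [].
have U_sub Q z : A z -> U Q z -> Q z by move=> Az [B [_ H] Oz]; exact: H.
apply: (U_sub P) => //.
apply: (connected_open_split cA (U_open P) (U_open (~` P))) => //.
- move=> z Az; have [B [oO Oz H]] := loc _ Az.
  have [Pz|nPz] := pselect (P z); [left|right]; exists B => //; split=> // y Ay Yy.
    exact/(H _ Ay Yy).
  by move=> /(H _ Ay Yy).
- by move=> z Az /(U_sub _ _ Az) Pz /(U_sub _ _ Az).
- exists p; split=> //; have [B [oO Op H]] := loc _ Ap.
  by exists B => //; split=> // y Ay Yy; exact/(H _ Ay Yy).
Qed.

Lemma ultra_fmap (T U : Type) (G : set_system T) (f : T -> U) :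
  UltraFilter G -> UltraFilter (f @ G).
Proof.
move=> GU; have PG : ProperFilter G := @ultra_proper _ _ GU.
split; first exact: fmap_proper_filter.
move=> K PK sub; apply/seteqP; split=> // A KA.
have [//|GA] := in_ultra_setVsetC (f @^-1` A) GU.
have KC : K (~` A) by apply: sub.
have [x [Ax nAx]] := @filter_ex _ _ PK _ (filterI KA KC).
by [].
Qed.

Section LimitCutPoint.
Variables (R : realType) (N : nat) (D : {set digit N}) (F : set (R * R)).
Hypothesis N_gt1 : (1 < N)%N.
Hypothesis att : is_attractor D F.
Hypothesis cF : connected F.

Lemma co_continuous ax : continuous (co ax : R * R -> R).
Proof. by case: ax => p; [exact: cvg_snd|exact: cvg_fst]. Qed.

Definition star m p : set (R * R) :=
  \bigcup_(t in [set t : m.-tuple (digit N) | t \in verts D m /\ cell F t p]) cell F t.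

Lemma star_connected m p : connected (star m p).
Proof.
apply: bigcup_connected; last by move=> t _; exact: cell_connected.
by exists p => t [].
Qed.

Lemma star_sub m p : star m p `<=` F.
Proof. by move=> z [t [/verts_word [_ tD] _]]; exact: (cell_sub att tD). Qed.

Lemma star_mem m p : F p -> star m p p.
Proof.
by move=> /(cell_cover att m)[w /word_tuple[t tV <-] tp]; exists t.
Qed.

(** The cells of level [m] that miss [p] are finitely many closed sets; remove their union. *)
Lemma star_nbhs m p : exists B, [/\ open B, B p & B `&` F `<=` star m p].
Proof.
pose S := [set t : m.-tuple (digit N) | `[< ~ cell F t p >] ]%SET.
exists (~` cells F S); split.
- by apply: closed_openC; exact: (cells_closed att).
- by move=> [t /=]; rewrite inE => /asboolP.
- move=> z [nz Fz]; have [w /word_tuple[t tV <-] tz] := cell_cover att m Fz.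
  exists t => //; split=> //; apply: contrapT => ntp; apply: nz.
  by exists t => //=; rewrite inE; apply/asboolP.
Qed.

Lemma star_diam m p z ax : star m p z -> `|co ax z - co ax p| * N%:R ^+ m <= 1.
Proof.
move=> [t [_ tp] tz]; rewrite -[X in _ ^+ X](size_tuple t).
exact: (cell_diam N_gt1 att).
Qed.

(** The constant 3 exceeds 1 + 1, the rescaled radii of a star around [p] and of the region around
    [x] that holds the cells [v k]. *)
Lemma neq_far (p x : R * R) : p <> x -> exists ax m, 3 < `|co ax p - co ax x| * N%:R ^+ m.
Proof.
move=> px; apply: contrapT => none; apply: px; apply: co_inj => ax.
apply/eqP; rewrite -subr_eq0 -normr_le0; apply: (geometric_le0 N_gt1 (C := 3)) => m.
by rewrite leNgt; apply/negP => H; apply: none; exists ax, m.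
Qed.

Lemma dist_triangle (a b c e r s : R) : 0 <= e -> `|a - b| * e <= r -> `|b - c| * e <= s ->
  `|a - c| * e <= r + s.
Proof.
move=> e0 h1 h2; apply: le_trans (lerD h1 h2); rewrite -mulrDl ler_wpM2r //.
by rewrite -[a - c](subrKA b) ler_normD.
Qed.

Lemma scale_mono (d : R) m k : (m <= k)%N -> 0 <= d -> d * N%:R ^+ k <= 1 -> d * N%:R ^+ m <= 1.
Proof.
move=> mk d0; apply: le_trans; rewrite ler_wpM2l // ler_weXn2l //.
by have := natr_ge2 R N_gt1; lra.
Qed.

(* The cells [v k] shrink along an ultrafilter [G] to a point [x].  A point
   [p <> x] is put on the side of [A] when it lies in [A k] for [G]-almost all
   [k]; as a star of small cells around [p] misses [v k] for [G]-almost all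
   [k], the two sides are relatively open. *)
Lemma cut_point_of_splitting_cells (k0 : nat) :
  (forall k, (k0 <= k)%N -> exists v A, splitting_cell D F k v A) ->
  has_cut_point F.
Proof.
move=> H.
have /choice [f hf] : forall k, exists vAq : seq (digit N) * set (R * R) * (R * R),
    (k0 <= k)%N -> splitting_cell D F k vAq.1.1 vAq.1.2 /\ cell F vAq.1.1 vAq.2.
  move=> k; have [kk|kk] := leqP k0 k; last first.
    (* Dummy values below [k0]; the ultrafilter ignores these indices. *)
    by exists ([::], set0, (0, 0)) => h; lia.
  have [v [A sp]] := H _ kk; have [q vq] := cell_neq0 att v.
  by exists (v, A, q).
pose v k := (f k).1.1; pose A k := (f k).1.2; pose q k := (f k).2.
have {}hf k : (k0 <= k)%N -> splitting_cell D F k (v k) (A k) /\ cell F (v k) (q k).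
  exact: hf.
have [G [GU sG]] := ultraFilterLemma eventually_filter.
have PG : ProperFilter G := @ultra_proper _ _ GU.
have late m : \forall k \near G, (m <= k)%N by apply: sG; exact: nbhs_infty_ge.
have GF : (q @ G) F.
  apply: filterS (late k0) => k /hf [[[_ vD] _ _ _] vq].
  exact: (cell_sub att vD).
have [_ cpt _] := att; move: cpt; rewrite compact_ultra => cpt.
have [x [Fx qx]] := cpt _ (ultra_fmap q GU) GF.
(* At level m + 1 the diameter of [v k] and the distance from [q k] to [x] contribute 1 each; one
   factor N >= 2 absorbs the sum. *)
have shrink m : \forall k \near G, forall y ax, cell F (v k) y ->
    `|co ax y - co ax x| * N%:R ^+ m <= 1.
  have close ax : \forall k \near G, `|co ax x - co ax (q k)| * N%:R ^+ m.+1 <= 1.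
    have Nm : 0 < N%:R ^+ m.+1 :> R by rewrite exprn_gt0 // ltr0n; lia.
    have cv : (co ax \o q) k @[k --> G] --> co ax x.
      exact: (cvg_comp _ _ qx (@co_continuous ax x)).
    have /cvgr_dist_le := cv => /(_ (N%:R ^+ m.+1)^-1).
    rewrite invr_gt0 Nm => /(_ isT); apply: filterS => k /= h.
    by rewrite -ler_pdivlMr // div1r.
  near=> k => y ax vy.
  have kk : (k0 <= k)%N by near: k; exact: late.
  have [[[sv _] _ _ _] vq] := hf _ kk.
  have h1 : `|co ax y - co ax (q k)| * N%:R ^+ m.+1 <= 1.
    apply: (scale_mono (k := k)) => //; first by near: k; exact: late.
    by have := cell_diam N_gt1 att ax vy vq; rewrite sv.
  have h2 : `|co ax (q k) - co ax x| * N%:R ^+ m.+1 <= 1.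
    rewrite distrC; case: ax {h1}; near: k; exact: close.
  have := dist_triangle (exprn_ge0 m.+1 (ler0n R N)) h1 h2.
  have N2 := natr_ge2 R N_gt1.
  have d0 : 0 <= `|co ax y - co ax x| * N%:R ^+ m by rewrite mulr_ge0 // exprn_ge0.
  rewrite exprS mulrCA; nra.
pose P := [set p | \forall k \near G, A k p].
have loc p : (F `\` [set x]) p -> exists B, [/\ open B, B p &
    forall z, (F `\` [set x]) z -> B z -> P z <-> P p].
  move=> [Fp px]; have [ax [m far]] := neq_far px.
  have [B [oO Op sub]] := star_nbhs m p.
  exists B; split=> // z [Fz _] Oz.
  have miss : \forall k \near G, A k `&` star m p !=set0 -> star m p `<=` A k.
    near=> k => ne; have kk : (k0 <= k)%N by near: k; exact: late.
    have [[_ absorb _ _] _] := hf _ kk.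
    apply: absorb; [exact: star_connected|exact: star_sub| |by rewrite setIC].
    move=> y sy vy.
    have h1 := star_diam ax sy; rewrite distrC in h1.
    have h2 : `|co ax y - co ax x| * N%:R ^+ m <= 1.
      have : forall y ax, cell F (v k) y -> `|co ax y - co ax x| * N%:R ^+ m <= 1.
        by near: k; exact: shrink.
      exact.
    by have := dist_triangle (exprn_ge0 m (ler0n R N)) h1 h2; lra.
  have sz : star m p z by exact: sub.
  have sp := star_mem m Fp.
  by split; apply: filterS2 miss => k h Az; apply: h => //; [exists z|exists p].
pose S := [set t : 6.-tuple (digit N) | `[< exists2 p, cell F t p &
   forall ax, `|co ax p - co ax x| * N%:R ^+ 6 <= 1 >] ]%SET.
have cS : (#|S| <= 16)%N.
  by apply: (card_near N_gt1 att (x := x)) => t; rewrite inE => /asboolP.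
(* There are finitely many words of level 6, so an ultrafilter turns a choice of [u] depending on
   [k] into a constant one. *)
have select (Q : nat -> 6.-tuple (digit N) -> Prop) :
    (\forall k \near G, exists2 u, u \in verts D 6 & u \notin S /\ Q k u) ->
    exists u, [/\ u \in verts D 6, u \notin S & \forall k \near G, Q k u].
  move=> hQ; apply: contrapT => none.
  have : \forall k \near G, forall u, ~ (u \in verts D 6 /\ u \notin S /\ Q k u).
    apply: filter_forall => u.
    have [h|//] := in_ultra_setVsetC [set k | u \in verts D 6 /\ u \notin S /\ Q k u] GU.
    have [k [uV [uS _]]] := filter_ex h.
    case: none; exists u; split=> //; apply: filterS h => l.
    by case=> _ [].
  move=> hn; have [k [[u uV [uS Qu]] /(_ u)]] := filter_ex (filterI hQ hn).
  by case.
have far u p : u \notin S -> cell F u p -> p <> x.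
  move=> uS up px; case/negP: uS; rewrite inE; apply/asboolP; exists p => // ax.
  by rewrite px subrr normr0 mul0r ler01.
have absorb u : u \in verts D 6 -> u \notin S ->
    \forall k \near G, cell F u `&` A k !=set0 -> cell F u `<=` A k.
  move=> /verts_word [_ uD] uS; near=> k; have kk : (k0 <= k)%N by near: k; exact: late.
  have [[_ absorb _ _] _] := hf _ kk.
  apply: absorb; [exact: (cell_connected cF)|exact: (cell_sub att uD)|].
  move=> p up vp; case/negP: uS; rewrite inE; apply/asboolP; exists p => // ax.
  have : forall y ax, cell F (v k) y -> `|co ax y - co ax x| * N%:R ^+ 6 <= 1.
    by near: k; exact: shrink.
  exact.
have [u [uV uS inA]] : exists u, [/\ u \in verts D 6, u \notin S &
    \forall k \near G, cell F u `&` A k !=set0].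
  by apply: select; apply: filterS (late k0) => k /hf [[_ _ h _] _]; exact: h.
have [w [wV wS outA]] : exists u, [/\ u \in verts D 6, u \notin S &
    \forall k \near G, ~ (cell F u `<=` A k)].
  by apply: select; apply: filterS (late k0) => k /hf [[_ _ _ h] _]; exact: h.
exists x; split=> // cFx.
have [p up] := cell_neq0 att u; have [z wz] := cell_neq0 att w.
have [_ uD] := verts_word uV; have [_ wD] := verts_word wV.
have Fp : (F `\` [set x]) p by split; [exact: (cell_sub att uD)|exact: (far u)].
have Fz : (F `\` [set x]) z by split; [exact: (cell_sub att wD)|exact: (far w)].
have Pp : P p.
  apply: filterS2 inA (absorb u uV uS) => k ne h; exact: h.
have Pz : P z := connected_locally_constant cFx loc Fp Fz Pp.
have [k [[Az h] n]] := filter_ex (filterI (filterI Pz (absorb w wV wS)) outA).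
by apply: n; apply: h; exists z.
Unshelve. all: by end_near. Qed.

End LimitCutPoint.

(** * Zooming into cut points *)

Section Cuts.
Variables (R : realType) (N : nat) (D : {set digit N}) (F : set (R * R)).
Hypothesis N_gt1 : (1 < N)%N.
Hypothesis D_gt1 : (1 < #|D|)%N.
Hypothesis att : is_attractor D F.
Hypothesis cF : connected F.
Hypothesis nfrag : ~ fragile D F.
Implicit Types (x p q : R * R) (U V : set (R * R)).

(** The sides are open sets of the plane, constrained only on [F] minus [x]; zooming then amounts to
    taking preimages. *)
Record cut x U V : Prop := Cut {
  cut_mem : F x;
  cut_openl : open U;
  cut_openr : open V;
  cut_cover : forall p, F p -> p <> x -> U p \/ V p;
  cut_disjoint : forall p, F p -> p <> x -> U p -> V p -> False;
  cut_left : exists p, [/\ F p, p <> x & U p];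
  cut_right : exists p, [/\ F p, p <> x & V p] }.

Lemma cut_sym x U V : cut x U V -> cut x V U.
Proof.
case=> Fx oU oV cov dis l r; split=> //.
  by move=> p Fp px; case: (cov p Fp px); [right|left].
by move=> p Fp px Vp Up; exact: (dis p).
Qed.

Lemma has_cut_point_cut : has_cut_point F -> exists x U V, cut x U V.
Proof.
move=> [x [Fx /connectedPn [E [ne FE [s1 s2]]]]].
have inF p : (F `\` [set x]) p <-> E false p \/ E true p by rewrite FE.
have mem p : F p -> p <> x -> E false p \/ E true p by move=> Fp px; apply/inF.
have dis b p : E b p -> ~ closure (E (~~ b)) p.
  case: b => /= Ep cEp.
    by have : (closure (E false) `&` E true) p by []; rewrite s1.
  by have : (E false `&` closure (E true)) p by []; rewrite s2.
have E_sub b p : E b p -> F p /\ p <> x.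
  by case: b => Ep; apply/inF; [right|left].
(* Each separated part avoids the closure of the other, so complements of closures serve as open
   sides. *)
exists x, (~` closure (E true)), (~` closure (E false)); split=> //.
- exact/closed_openC/closed_closure.
- exact/closed_openC/closed_closure.
- by move=> p Fp px; case: (mem p Fp px) => Ep; [left|right]; exact: dis Ep.
- move=> p Fp px nt nf; case: (mem p Fp px) => Ep.
    by apply: nf; exact: subset_closure.
  by apply: nt; exact: subset_closure.
- have [p Ep] := ne false; have [Fp px] := E_sub _ _ Ep.
  by exists p; split=> //; exact: (dis _ _ Ep).
- have [p Ep] := ne true; have [Fp px] := E_sub _ _ Ep.
  by exists p; split=> //; exact: (dis _ _ Ep).
Qed.

Lemma phi_inj (i : digit N) : injective (phi i : R * R -> R * R).
Proof. exact: (@phiw_inj R N N_gt1 [:: i]). Qed.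

Lemma piece_connected (i : digit N) : connected (phi i @` F).
Proof. exact: (@cell_connected R N F [:: i] cF). Qed.

Lemma piece_closed (i : digit N) : closed (phi i @` F).
Proof. exact: (@cell_closed _ _ _ _ att [:: i]). Qed.

Lemma piece_sub i : i \in D -> phi i @` F `<=` F.
Proof. by move=> iD; apply: (cell_sub (w := [:: i]) att); rewrite /= iD. Qed.

Lemma piece_cover p : F p -> exists2 i, i \in D & (phi i @` F) p.
Proof.
have [_ _ FE] := att; rewrite {1}FE => -[i /= iD ip].
by exists i.
Qed.

Lemma cut_one_side x U V X : cut x U V -> connected X -> X `<=` F ->
  ~ X x -> X `&` U !=set0 -> X `<=` U.
Proof.
move=> c cX XF nx ne.
have px p : X p -> p <> x by move=> Xp e; apply: nx; rewrite -e.
apply: (connected_open_split cX (cut_openl c) (cut_openr c)) => //.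
  by move=> p Xp; apply: (cut_cover c); [exact: XF|exact: px].
by move=> p Xp; apply: (cut_disjoint c); [exact: XF|exact: px].
Qed.

Lemma cut_preimage x x' U V i p q : cut x U V -> phi i x' = x -> F x' -> i \in D ->
  [/\ (phi i @` F) p, p <> x & U p] -> [/\ (phi i @` F) q, q <> x & V q] ->
  cut x' (phi i @^-1` U) (phi i @^-1` V).
Proof.
move=> c e Fx' iD [[p' Fp' ep] px Up] [[q' Fq' eq] qx Vq].
have F_phi z : F z -> F (phi i z) by move=> Fz; apply: (piece_sub iD); exists z.
have neq z : z <> x' -> phi i z <> x by move=> zx; rewrite -e => /phi_inj.
split=> //.
- by apply: open_comp (cut_openl c) => z _; exact: phi_continuous.
- by apply: open_comp (cut_openr c) => z _; exact: phi_continuous.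
- by move=> z Fz zx; apply: (cut_cover c); [exact: F_phi|exact: neq].
- by move=> z Fz zx; apply: (cut_disjoint c); [exact: F_phi|exact: neq].
- by exists p'; split=> //=; rewrite ?ep // => e'; apply: px; rewrite -ep e'.
- by exists q'; split=> //=; rewrite ?eq // => e'; apply: qx; rewrite -eq e'.
Qed.

Lemma Uimg_closed (S : {set digit N}) : closed (Uimg S F).
Proof. by apply: closed_bigcup => // i _; exact: piece_closed. Qed.

(** Otherwise the two closed unions of pieces would disconnect [F]. *)
Lemma Uimg_meet (S : {set digit N}) : S \subset D -> S != finset.set0 ->
  (D :\: S)%SET != finset.set0 -> Uimg S F `&` Uimg (D :\: S) F !=set0.
Proof.
move=> SD S0 DS0; apply: contrapT => none.
have [[p0 Fp0] _ FE] := att.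
have ne (S' : {set digit N}) : S' \subset D -> S' != finset.set0 -> F `&` Uimg S' F !=set0.
  move=> S'D /finset.set0Pn [i iS]; exists (phi i p0); split.
    by apply: (piece_sub (fintype.subsetP S'D _ iS)); exists p0.
  by exists i => //; exists p0.
have sub : F `<=` Uimg S F.
  apply: (connected_closed_split cF (@Uimg_closed S) (@Uimg_closed (D :\: S))) => //.
  - move=> p /piece_cover [i iD ip]; have [iS|iS] := boolP (i \in S).
      by left; exists i.
    by right; exists i => //=; rewrite inE iS.
  - by move=> p _ Sp DSp; apply: none; exists p.
  - exact: ne.
have [p [Fp Dp]] := ne _ (finset.subsetDl D S) DS0.
by apply: none; exists p; split=> //; exact: sub.
Qed.

(* Otherwise the digits of the pieces lying on the two sides of [x] form a
   partition of [D] witnessing fragility. *)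
Lemma cut_zoom x U V : cut x U V -> exists i x',
  [/\ i \in D, phi i x' = x & cut x' (phi i @^-1` U) (phi i @^-1` V)].
Proof.
move=> c.
have [[i [p [q [iD hp hq]]]]|none] := pselect (exists i p q, [/\ i \in D,
    [/\ (phi i @` F) p, p <> x & U p] & [/\ (phi i @` F) q, q <> x & V q]]).
  (* A piece missing [x] is a connected part of [F] minus [x] and would lie on one side. *)
  have [x' Fx' e] : (phi i @` F) x.
    apply: contrapT => nx; case: (hp) (hq) => [ip px Up] [iq qx Vq].
    have sub := cut_one_side c (@piece_connected i) (piece_sub iD) nx.
    apply: (cut_disjoint c (piece_sub iD iq) qx) => //.
    by apply: sub => //; exists p.
  by exists i, x'; split=> //; exact: cut_preimage hp hq.
exfalso; apply: nfrag.
pose D1 := [set i in D | `[< forall p, (phi i @` F) p -> p <> x -> U p >]]%SET.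
have D1D : D1 \subset D by apply/fintype.subsetP => i; rewrite inE => /andP[].
have D1P i p : i \in D1 -> (phi i @` F) p -> p <> x -> U p.
  by rewrite inE => /andP[_ /asboolP]; exact.
have D2P i p : i \in (D :\: D1)%SET -> (phi i @` F) p -> p <> x -> V p.
  rewrite inE => /andP[iD1 iD] ip px.
  case: (cut_cover c (piece_sub iD ip) px) => // Up.
  case/negP: iD1; rewrite inE iD; apply/asboolP => q iq qx.
  case: (cut_cover c (piece_sub iD iq) qx) => // Vq.
  by case: none; exists i, p, q.
have D10 : D1 != finset.set0.
  have [p [Fp px Up]] := cut_left c; have [i iD ip] := piece_cover Fp.
  apply/finset.set0Pn; exists i; apply: contrapT => /negP iD1.
  by apply: (cut_disjoint c Fp px Up); apply: (D2P i) => //; rewrite inE iD1.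
have D20 : (D :\: D1)%SET != finset.set0.
  have [p [Fp px Vp]] := cut_right c; have [i iD ip] := piece_cover Fp.
  apply/finset.set0Pn; exists i; rewrite inE iD andbT; apply/negP => iD1.
  by apply: (cut_disjoint c Fp px _ Vp); exact: (D1P i).
have only p : Uimg D1 F p -> Uimg (D :\: D1) F p -> p = x.
  move=> [i /= iD1 ip] [j /= jD jp]; apply: contrapT => px.
  apply: (cut_disjoint c _ px (D1P i p iD1 ip px) (D2P j p jD jp px)).
  exact: (piece_sub (fintype.subsetP D1D _ iD1)).
exists D1; split=> //; exists x; apply/seteqP; split=> [p [h1 h2]|_ ->].
  exact: only.
by have [p [h1 h2]] := Uimg_meet D1D D10 D20; rewrite -(only _ h1 h2).
Qed.

Lemma cut_zoom_word k x U V : cut x U V -> exists w x',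
  [/\ word D k w, phiw w x' = x & exists U' V', cut x' U' V'].
Proof.
elim: k x U V => [|k IH] x U V c.
  by exists [::], x; split=> //; exists U, V.
have [i [x' [iD e c']]] := cut_zoom c.
have [w [y [[sw wD] ey hc]]] := IH _ _ _ c'.
exists (i :: w), y; split=> //=; last by rewrite ey.
by split; rewrite /= ?sw // iD.
Qed.

(** * Cut points with a unique address *)

Definition cells_at k x := [set t in verts D k | `[< cell F t x >]]%SET.

(** Prefixing [w] embeds the cells around [x'] into those around [x]. A second cell of level [k] at
    [x] has a descendant at [x] that begins differently and is missed. *)
Lemma cells_at_zoom k m w x x' : word D k w -> phiw w x' = x ->
  (#|cells_at m x'| <= #|cells_at (k + m) x|)%N /\
  ((1 < #|cells_at k x|)%N -> (#|cells_at m x'| < #|cells_at (k + m) x|)%N).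
Proof.
move=> /word_tuple [u uV <-] {w} e.
pose f (t : m.-tuple (digit N)) := cat_tuple u t.
have f_inj : injective f.
  move=> t t' /(congr1 val) /= /eqP; rewrite eqseq_cat // eqxx => /eqP.
  exact: val_inj.
have sub : f @: cells_at m x' \subset cells_at (k + m) x.
  apply/fintype.subsetP => _ /imsetP [t + ->]; rewrite !inE.
  move=> /andP[tD /asboolP [y Fy ey]]; rewrite all_cat tD andbT.
  move: uV; rewrite inE => -> /=; apply/asboolP.
  by exists y => //=; rewrite phiw_cat ey.
split; first by rewrite -(card_imset _ f_inj); exact: subset_leq_card.
move=> /card_gt1P [a [b [aS bS ab]]].
have [w [wS wu]] : exists w, w \in cells_at k x /\ w != u.
  have [eau|] := eqVneq a u; last by exists a.
  by exists b; split=> //; rewrite -eau eq_sym.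
move: wS; rewrite inE => /andP[wV /asboolP wx].
have [v0 wv0 cv0] := cell_refine att m wx.
have [v vV ev] := word_tuple wv0; rewrite -{}ev in cv0.
rewrite -(card_imset _ f_inj); apply: proper_card; apply/fintype.properP; split=> //.
exists (cat_tuple w v).
  rewrite !inE all_cat; move: wV vV; rewrite !inE => -> -> /=.
  exact/asboolP.
apply/imsetP => -[t _ /(congr1 val) /= /eqP]; rewrite eqseq_cat ?size_tuple //.
by move=> /andP[/eqP/val_inj ewu _]; rewrite ewu eqxx in wu.
Qed.

Lemma cells_at_bound k x : (#|cells_at k x| <= 16)%N.
Proof.
apply: (card_near N_gt1 att (x := x)) => t; rewrite inE => /andP[_ /asboolP tx].
by exists x => // ax; rewrite subrr normr0 mul0r ler01.
Qed.

Definition unique_address x := forall k, (#|cells_at k x| <= 1)%N.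

(* Zooming into one of several cells of the same level containing the cut
   point lowers the number of cells around it. *)
Lemma unique_address_cut x U V : cut x U V ->
  exists x' U' V', cut x' U' V' /\ unique_address x'.
Proof.
have : forall k, (#|cells_at k x| <= 16)%N by move=> k; exact: cells_at_bound.
elim: (16)%N x U V => [|M IH] x U V hM c.
  by exists x, U, V; split=> // k; exact: leq_trans (hM k) _.
have [h|] := pselect (unique_address x); first by exists x, U, V.
move=> /existsNP [k /negP]; rewrite -ltnNge => hk.
have [w [x' [ww e [U' [V' c']]]]] := cut_zoom_word k c.
apply: (IH x' U' V') => // m.
rewrite -ltnS; apply: leq_trans (hM (k + m)%N).
exact: (cells_at_zoom m ww e).2.
Qed.

Lemma unique_address_zoom i x x' : i \in D -> phi i x' = x ->
  unique_address x -> unique_address x'.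
Proof.
move=> iD e ux m; have wi : word D 1 [:: i] by split=> //=; rewrite iD.
exact: leq_trans (cells_at_zoom m wi e).1 (ux _).
Qed.

Lemma unique_word k x (s t : k.-tuple (digit N)) : unique_address x ->
  s \in verts D k -> t \in verts D k -> cell F s x -> cell F t x -> s = t.
Proof.
move=> /(_ k) /card_le1_eqP h sV tV sx tx.
by apply: h; rewrite inE ?sV ?tV /=; apply/asboolP.
Qed.

Lemma unique_digit x i j : unique_address x -> i \in D -> j \in D ->
  (phi i @` F) x -> (phi j @` F) x -> i = j.
Proof.
move=> ux iD jD ix jx.
have := @unique_word 1 x [tuple i] [tuple j] ux.
rewrite !inE /= iD jD => /(_ isT isT ix jx) /(congr1 val) /=.
by case.
Qed.

(** Connectedness gives one contact; if it were the only one, [a] against the other digits would be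
    a fragile partition. *)
Lemma two_contacts a : a \in D ->
  exists z z', [/\ contact D F a z, contact D F a z' & z <> z'].
Proof.
move=> aD; apply: contrapT => none; apply: nfrag.
have cP p : Uimg [set a]%SET F p -> Uimg (D :\ a) F p -> exists2 z, contact D F a z & phi a z = p.
  move=> [b /=]; rewrite inE => /eqP -> [z Fz e] [j /=].
  rewrite !inE => /andP[/eqP ja jD] [q Fq eq].
  exists z => //; split=> //; exists j, q; split=> // ax.
  have h1 := (phiP N_gt1 a z p).1 e ax; have h2 := (phiP N_gt1 j q p).1 eq ax.
  by rewrite -h1 -h2.
have a0 : [set a]%SET != finset.set0 by apply/finset.set0Pn; exists a; rewrite inE.
have sa : [set a]%SET \subset D by rewrite finset.sub1set.
have Da0 : (D :\ a)%SET != finset.set0.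
  move: D_gt1; rewrite (cardsD1 a) aD -card_gt0.
  by rewrite add1n ltnS.
have [p [h1 h2]] := Uimg_meet sa a0 Da0.
exists [set a]%SET; split=> //; exists p; apply/seteqP; split=> [q [h3 h4]|_ -> //].
have [z cz <-] := cP _ h3 h4; have [z' cz' <-] := cP _ h1 h2.
by congr phi; apply: contrapT => zz'; apply: none; exists z, z'.
Qed.

Definition ucut x U V := cut x U V /\ unique_address x.

Definition lone (a : digit N) V := forall i, i \in D -> i <> a -> phi i @` F `<=` V.

(** * Cut points with all other pieces on one side *)

Section NoSplitting.
Hypothesis no_split : forall x U V i j, ucut x U V -> i \in D -> j \in D ->
  ~ (phi i @` F) x -> ~ (phi j @` F) x -> phi i @` F `<=` U -> phi j @` F `<=` V -> False.

(** By uniqueness of the address the other pieces miss [x], so each lies on one side, and [no_split]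
    makes the side common. *)
Lemma lone_side x U V a : ucut x U V -> a \in D -> (phi a @` F) x ->
  lone a U \/ lone a V.
Proof.
move=> [c ux] aD ax; have [h|/existsNP [i /not_implyP [iD /not_implyP [ia nU]]]] := pselect (lone a U).
  by left.
have out j : j \in D -> j <> a -> ~ (phi j @` F) x.
  by move=> jD ja jx; apply: ja; exact: (unique_digit ux).
have pure j : j \in D -> j <> a -> phi j @` F `<=` U \/ phi j @` F `<=` V.
  move=> jD ja; have nx := out _ jD ja; have [p jp] := cell_neq0 att [:: j].
  have px : p <> x by move=> e; apply: nx; rewrite -e.
  case: (cut_cover c (piece_sub jD jp) px) => h; [left|right].
    by apply: (cut_one_side c (@piece_connected j) (piece_sub jD) nx); exists p.
  by apply: (cut_one_side (cut_sym c) (@piece_connected j) (piece_sub jD) nx); exists p.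
right=> j jD ja; case: (pure j jD ja) => // jU.
have iV : phi i @` F `<=` V by case: (pure i iD ia).
by exfalso; apply: (no_split (conj c ux) jD iD (out _ jD ja) (out _ iD ia) jU iV).
Qed.

Lemma ucut_contact x U V a x' z : ucut x U V -> a \in D -> phi a x' = x -> F x' ->
  lone a V -> contact D F a z -> V (phi a z) /\ z <> x'.
Proof.
move=> [c ux] aD e Fx' la [Fz [j [q [jD ja Fq ez]]]].
have eq : phi j q = phi a z.
  apply/(phiP N_gt1) => ax; rewrite -ez.
  exact: (phiP N_gt1 a z (phi a z)).1.
have jz : (phi j @` F) (phi a z) by exists q.
split; first exact: la jz.
move=> zx; apply: ja; apply: (unique_digit ux) => //; first by rewrite -e -zx.
by exists x'.
Qed.

(** Contacts of [a] are sent to side V. When the side changes at the zoom, all pieces but that of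
    [b] are on side U, so [b] must hold the contacts. *)
Lemma contact_confined x U V a x' b : ucut x U V -> a \in D -> phi a x' = x ->
  cut x' (phi a @^-1` U) (phi a @^-1` V) ->
  lone a V -> lone b (phi a @^-1` U) ->
  forall z, contact D F a z -> in_piece F b z.
Proof.
move=> u aD e c' la lb z cz; have Fz : F z by case: cz.
have [Vz zx] := ucut_contact u aD e (cut_mem c') la cz.
have [i iD iz] := piece_cover Fz.
have [eib|/eqP ib] := eqVneq i b.
  by apply/(in_pieceP F N_gt1); rewrite -eib.
by exfalso; apply: (cut_disjoint c' Fz zx _ Vz); exact: (lb i).
Qed.

(** A change of side confines the contacts of [a] to piece [b]; one further zoom then gives a
    contradiction whether or not the side changes again. *)
Lemma lone_persists x U V a x' b : ucut x U V -> a \in D -> phi a x' = x ->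
  cut x' (phi a @^-1` U) (phi a @^-1` V) ->
  lone a V -> b \in D -> (phi b @` F) x' -> lone b (phi a @^-1` V).
Proof.
move=> u aD e c' la bD bx.
have ux' : unique_address x' by apply: unique_address_zoom aD e _; case: u.
case: (lone_side (conj c' ux') bD bx) => // lb; exfalso.
have F01 p ax : F p -> 0 <= co ax p <= 1 by exact: (attractor_unit N_gt1 att).
have FE := attractorE att.
have H := contact_confined u aD e c' la lb.
have [i [x'' [iD e' c'']]] := cut_zoom c'.
have eib : i = b by apply: (unique_digit ux') => //; exists x''; case: c''.
rewrite {i}eib in iD e' c''.
have ux'' := unique_address_zoom bD e' ux'.
have [j [y [jD ey cy]]] := cut_zoom c''.
have jx : (phi j @` F) x'' by exists y => //; exact: cut_mem cy.
case: (lone_side (conj c'' ux'') jD jx) => lj.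
(* No second change: the contacts of [a], still on side V, are confined to the cell of [b] and
   [j]. *)
- apply: (contact_not_in_subpiece N_gt1 F01 FE two_contacts aD bD H (c := j)).
  move=> z cz; have [z1 Fz1 ez1] := H _ cz.
  exists z1; split=> //.
  have ephi : phi b z1 = z by apply/(phiP N_gt1).
  have [Vz zx] := ucut_contact u aD e (cut_mem c') la cz.
  have zx1 : z1 <> x'' by move=> h; apply: zx; rewrite -ephi h.
  have [i iD' iz] := piece_cover Fz1.
  have [eij|/eqP ij] := eqVneq i j.
    by apply/(in_pieceP F N_gt1); rewrite -eij.
  exfalso; apply: (cut_disjoint c'' Fz1 zx1); first exact: (lj i).
  by rewrite /= ephi.
(* A second change: the contacts of [b] are confined to piece [j]. *)
- apply: (contact_not_nested N_gt1 F01 FE two_contacts aD bD jD H).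
  exact: (contact_confined (conj (cut_sym c') ux') bD e' (cut_sym c'') lb lj).
Qed.

(** Side U lies in the piece of [a], and by [lone_persists] the same holds after each zoom, so it
    lies in cells of every level around [x]. *)
Lemma lone_shrinks k x U V a : ucut x U V -> a \in D -> (phi a @` F) x -> lone a V ->
  forall p ax, F p -> p <> x -> U p -> `|co ax p - co ax x| * N%:R ^+ k <= 1.
Proof.
elim: k x U V a => [|k IH] x U V a u aD ax la p d Fp px Up.
  have /andP[? ?] := attractor_unit N_gt1 att d Fp.
  have /andP[? ?] := attractor_unit N_gt1 att d (cut_mem u.1).
  by rewrite expr0 mulr1 ler_norml; apply/andP; split; lra.
have [i iD [p' Fp' ep]] := piece_cover Fp.
have eia : i = a.
  apply: contrapT => ia; apply: (cut_disjoint u.1 Fp px Up).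
  by apply: (la i iD ia); exists p'.
rewrite {i iD}eia in ep.
have [i [x' [iD e c']]] := cut_zoom u.1.
have eia : i = a by apply: (unique_digit u.2) => //; exists x' => //; exact: cut_mem c'.
rewrite {i iD}eia in e c'.
have ux' := unique_address_zoom aD e u.2.
have [b [y [bD ey cy]]] := cut_zoom c'.
have bx : (phi b @` F) x' by exists y => //; exact: cut_mem cy.
have lb := lone_persists u aD e c' la bD bx.
have px' : p' <> x' by move=> h; apply: px; rewrite -ep -e h.
have Up' : (phi a @^-1` U) p' by rewrite /= ep.
have := IH _ _ _ b (conj c' ux') bD bx lb p' d Fp' px' Up'.
have h1 := (phiP N_gt1 a p' p).1 ep d; have h2 := (phiP N_gt1 a x' x).1 e d.
have -> : co d p' - co d x' = (co d p - co d x) * N%:R by rewrite mulrBl h1 h2; lra.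
by rewrite normrM (ger0_norm (ler0n R N)) -mulrA -exprS.
Qed.

Lemma splitting_contradiction x U V : ~ ucut x U V.
Proof.
move=> u; have [a [x' [aD e c']]] := cut_zoom u.1.
have ax : (phi a @` F) x by exists x' => //; exact: cut_mem c'.
have shrink W W' : ucut x W W' -> lone a W' -> False.
  move=> {}u la; have [p [Fp px Wp]] := cut_left u.1.
  apply: (px); apply: co_inj => d; apply/eqP; rewrite -subr_eq0 -normr_le0.
  apply: (geometric_le0 N_gt1 (C := 1)) => k.
  exact: lone_shrinks u aD ax la p d Fp px Wp.
case: (lone_side u aD ax) => la; last exact: (shrink U V).
exact: (shrink V U (conj (cut_sym u.1) u.2)).
Qed.

End NoSplitting.

Lemma split_cut : has_cut_point F -> exists x U V i j,
  [/\ ucut x U V, i \in D, j \in D, ~ (phi i @` F) x /\ ~ (phi j @` F) x &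
      phi i @` F `<=` U /\ phi j @` F `<=` V].
Proof.
move=> /has_cut_point_cut [x0 [U0 [V0 c0]]].
have [x [U [V u]]] := unique_address_cut c0.
apply: contrapT => none; apply: (splitting_contradiction _ u).
move=> y U' V' i j uy iD jD iy jy iU jV; apply: none.
by exists y, U', V', i, j.
Qed.

(** * Cut vertices from a split cut point *)

Definition descendants k (i : digit N) : {set k.+1.-tuple (digit N)} :=
  (fun t : k.-tuple (digit N) => cons_tuple i t) @: verts D k.

Lemma card_descendants k i : #|descendants k i| = (#|D| ^ k)%N.
Proof.
rewrite card_imset ?card_verts // => t t' /(congr1 val) /= [].
exact: val_inj.
Qed.

Lemma cells_descendants k i : i \in D -> cells F (descendants k i) = phi i @` F.
Proof.
move=> iD; apply/seteqP; split=> p.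
  move=> [_ /imsetP [t tV ->] [q Fq <-]]; exists (phiw t q) => //.
  by have [_ tD] := verts_word tV; apply: (cell_sub att tD); exists q.
move=> [q Fq <-]; have [w /word_tuple[t tV <-] [r Fr e]] := cell_cover att k Fq.
exists (cons_tuple i t); first by apply/imsetP; exists t.
by exists r => //=; rewrite e.
Qed.

(** The cut vertex is the only cell of level k + 1 containing [x]. The |D|^k descendants of [i] have
    a connected union missing [x], hence share a component; likewise for [j] on the other side. *)
Lemma split_cut_chi x U V i j k : ucut x U V -> i \in D -> j \in D ->
  ~ (phi i @` F) x -> ~ (phi j @` F) x -> phi i @` F `<=` U -> phi j @` F `<=` V ->
  (#|D| ^ k <= chiGamma D F k.+1)%N.
Proof.
move=> [c ux] iD jD ix jx iU jV.
have [w /word_tuple [v vV <-] {w} vx] := cell_cover att k.+1 (cut_mem c).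
pose W := (verts D k.+1 :\ v)%SET.
have Wx t : t \in W -> ~ cell F t x.
  rewrite in_setD1 => /andP[tv tV] tx; move/negP: tv; apply; apply/eqP.
  exact: (unique_word ux).
have sub l : l \in D -> ~ (phi l @` F) x -> descendants k l \subset W.
  move=> lD lx; apply/fintype.subsetP => t tl; rewrite in_setD1; apply/andP; split.
    apply/eqP => tv; apply: lx; rewrite -(cells_descendants k lD).
    by exists t => //; rewrite tv.
  case/imsetP: tl => u uV ->; move: uV; rewrite !inE /= => ->.
  by rewrite lD.
have [t0 t0V] : exists t0, t0 \in verts D k.
  apply/finset.set0Pn; rewrite -card_gt0 card_verts expn_gt0.
  by rewrite (ltnW D_gt1).
pose t l : k.+1.-tuple (digit N) := cons_tuple l t0.
have tl l : t l \in descendants k l by apply/imsetP; exists t0.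
have in_comp l : l \in D -> ~ (phi l @` F) x ->
    descendants k l \subset component (gedge F k.+1) W (t l).
  move=> lD lx; apply: (cells_in_component att); [exact: sub|exact: tl|].
  by rewrite cells_descendants //; exact: piece_connected.
have tW l : l \in D -> ~ (phi l @` F) x -> t l \in W.
  by move=> lD lx; exact: (fintype.subsetP (sub l lD lx)).
have t_sub l : l \in D -> cell F (t l) `<=` phi l @` F.
  by move=> lD p tp; rewrite -(cells_descendants k lD); exists (t l) => //; exact: tl.
apply/chi_geP; first by rewrite expn_gt0 (ltnW D_gt1).
exists v, (component (gedge F k.+1) W (t i)), (component (gedge F k.+1) W (t j)).
split=> //.
- by apply: component_in; exact: tW.
- by apply: component_in; exact: tW.
- apply/eqP => e.
  have tj : t j \in component (gedge F k.+1) W (t i).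
    by rewrite e; apply: component_mem; exact: tW.
  have [p jp] := cell_neq0 att (t j).
  have px : p <> x by move=> h; apply: jx; rewrite -h; exact: t_sub.
  have Fp : F p by apply: (piece_sub jD); exact: t_sub.
  apply: (cut_disjoint c Fp px); last by apply: jV; exact: t_sub.
  (* Inclusion in [U] spreads along edges: adjacent cells meet, and a cell missing [x] lies on one
     side. *)
  have : forall s, s \in component (gedge F k.+1) W (t i) -> cell F s `<=` U.
    apply: component_inv; last by apply: subset_trans iU; exact: t_sub.
    move=> y z yW zW /andP[_ /asboolP [q [yq zq]]] yU.
    have [_ zD] : word D k.+1 z by apply: verts_word; move: zW; rewrite in_setD1 => /andP[].
    apply: (cut_one_side c (@cell_connected R N F z cF) (cell_sub att zD) (Wx _ zW)).
    by exists q; split=> //; exact: yU.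
  by move=> /(_ _ tj); exact.
- rewrite -{1}(card_descendants k i) -(card_descendants k j).
  by split; apply: subset_leq_card; exact: in_comp.
Qed.

End Cuts.

Theorem mainTheorem4 (R : realType) (N : nat) (D : {set digit N})
  (F : set (R * R)) :
  (2 <= N)%N -> (1 < #|D|)%N -> (#|D| < N ^ 2)%N ->
  is_attractor D F ->
  connected F ->
  ~ fragile D F ->
  (has_cut_point F <->
     (forall k : nat, (2 <= k)%N -> (#|D| ^ k.-1 <= chiGamma D F k)%N))
  /\
  ((exists k0 : nat, (2 <= k0)%N /\
      forall k : nat, (k0 <= k)%N -> (#|D| ^ k.-1 <= chiGamma D F k)%N) ->
   has_cut_point F).
Proof.
move=> N_gt1 D_gt1 _ att cF nfrag.
have limit : (exists k0 : nat, (2 <= k0)%N /\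
    forall k : nat, (k0 <= k)%N -> (#|D| ^ k.-1 <= chiGamma D F k)%N) -> has_cut_point F.
  move=> [k0 [_ H]].
  (* Levels start at 6 so that each word has a prefix of length 6. *)
  apply: (cut_point_of_splitting_cells N_gt1 att cF (k0 := maxn k0 6)) => k.
  rewrite geq_max => /andP[k0k k6]; apply: (splitting_cell_exists D_gt1 att k6).
  exact: H.
split=> //; split; last by move=> H; apply: limit; exists 2%N.
move=> /(split_cut N_gt1 D_gt1 att cF nfrag) [x [U [V [i [j [u iD jD [ix jx] [iU jV]]]]]]].
case=> // k _.
exact: (split_cut_chi D_gt1 att cF k u iD jD ix jx iU jV).
Qed.
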